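(* There exists $\lambda_1>0$ such that, for fixed $\lambda_0\in(0,\lambda_1)$, there exists $\delta>0$ with the following property. If $\Delta=(\Delta x,\Delta t)$ satisfies $0<\lambda_0\le\lambda=\Delta t/\Delta x<\lambda_1$ and $\Delta x\le\delta$, then for every $c\in[c_0,c_1]$ the Lax-Friedrichs scheme starting from any $u^0\in L^\infty_{r,0}(\mathbb T)$ succeeds up to an arbitrary time index (that is, it produces $u^k_m$ for all $k\ge 0$) and satisfies the CFL condition $$|H_p(x_m,t_k,c+u^k_m)|\le\lambda_1^{-1}<\lambda^{-1}\quad\text{for all }m\in\mathbb Z\text{ and all integers }k\ge0\text{ (with }m+k\text{ even)}.$$
   Context: $\mathbb T=\mathbb R/\mathbb Z$. The flux $H=H(x,t,p):\mathbb T^2\times\mathbb R\to\mathbb R$ satisfies: (A1) $H$ is $C^2$; (A2) $H_{pp}>0$; (A3) $\lim_{|p|\to\infty}H(x,t,p)/|p|=+\infty$; (A4) the Legendre transform $L(x,t,\xi)=\sup_{p\in\mathbb R}\{\xi p-H(x,t,p)\}$ satisfies $|L_x|\le\alpha(|L|+1)$ for some $\alpha>0$. Real numbers $r>0$ and $c_0\le c_1$ are arbitrarily fixed. $L^\infty_{r,0}(\mathbb T)$ is the set of $u^0\in L^\infty(\mathbb T)$ with $\|u^0\|_{L^\infty}\le r$ and $\int_{\mathbb T}u^0\,dx=0$. Mesh: $N\le K$ are natural numbers, $\Delta x=(2N)^{-1}$, $\Delta t=(2K)^{-1}$, $\Delta=(\Delta x,\Delta t)$, $\lambda=\Delta t/\Delta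 x$, $x_m=m\Delta x$ ($m\in\mathbb Z$), $t_k=k\Delta t$ ($k=0,1,2,\dots$). Lax-Friedrichs scheme for $u_t+H(x,t,c+u)_x=0$ with initial data $u^0$: the unknowns $u^k_m$ are indexed by $m+k$ even and satisfy $$\frac{u^{k+1}_{m+1}-\frac{u^k_m+u^k_{m+2}}2}{\Delta t}+\frac{H(x_{m+2},t_k,c+u^k_{m+2})-H(x_m,t_k,c+u^k_m)}{2\Delta x}=0,\qquad u^k_{m\pm2N}=u^k_m,$$ with $u^0_m=\frac1{2\Delta x}\int_{x_m-\Delta x}^{x_m+\Delta x}u^0(y)\,dy$ for $m$ even. *)

(* Defs.v *)
From mathcomp Require Import all_boot all_order all_algebra.
From mathcomp Require Import all_classical all_reals all_analysis.

Set Implicit Arguments.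
Unset Strict Implicit.
Unset Printing Implicit Defensive.

Import Order.TTheory GRing.Theory Num.Theory.
Import numFieldNormedType.Exports.

Local Open Scope classical_set_scope.
Local Open Scope ring_scope.

(* A function on the torus R/Z is represented by its 1-periodic lift to R. *)

(* C^n in the sense of Frechet differentiability with every directional
   derivative of class C^(n-1). *)
Fixpoint class_C (R : realType) (V : normedModType R) (n : nat) (f : V -> R)
    : Prop :=
  match n with
  | 0 => continuous f
  | n'.+1 => (forall z, differentiable f z) /\
             (forall v, class_C n' ('D_v f))
  end.

Section hamiltonian.
Context {R : realType}.
Implicit Types H : R -> R -> R -> R.

Definition space_time_periodic H : Prop :=
  (forall t p, periodic (fun x => H x t p) 1) /\
  (forall x p, periodic (fun t => H x t p) 1).

Definition smooth_flux H : Prop :=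
  class_C 2 (fun z : R * R * R => H z.1.1 z.1.2 z.2).

Definition Hp H (x t p : R) : R := derive1 (H x t) p.

Definition Hpp H (x t p : R) : R := derive1n 2 (H x t) p.

Definition convex_flux H : Prop := forall x t p, 0 < Hpp H x t p.

Definition superlinear_flux H : Prop := forall x t,
  (H x t p / `|p| @[p --> +oo] --> +oo) /\
  (H x t p / `|p| @[p --> -oo] --> +oo).

(* [sup] is only meaningful on nonempty bounded sets; superlinearity of [H]
   guarantees that the set is bounded above.  For a C^2, strictly convex and
   superlinear [H] the transform is C^1, so [legendre_x] is a genuine
   derivative. *)
Definition legendre H (x t xi : R) : R := sup [set xi * p - H x t p | p in setT].

Definition legendre_x H (x t xi : R) : R :=
  derive1 (fun y => legendre H y t xi) x.

Definition legendre_growth H : Prop := exists2 alpha : R, 0 < alpha &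
  forall x t xi, `|legendre_x H x t xi| <= alpha * (`|legendre H x t xi| + 1).

Definition admissible_flux H : Prop :=
  [/\ space_time_periodic H, smooth_flux H, convex_flux H,
      superlinear_flux H & legendre_growth H].

End hamiltonian.

Section lax_friedrichs.
Context {R : realType}.

(* For a 1-periodic function the essential supremum over R is the one over the
   torus. *)
Definition Linfty_r0 (r : R) : set (R -> R) := [set u0 : R -> R |
  [/\ measurable_fun setT u0,
      periodic u0 1,
      ('N[lebesgue_measure]_+oo[EFin \o u0] <= r%:E)%E &
      \int[lebesgue_measure]_(x in `[0, 1]) u0 x = 0]].

Definition mesh (N : nat) : R := (2 * N%:R)^-1.

Definition node (d : R) (m : int) : R := m%:~R * d.

(* The mesh function [u k m] stands for $u^k_m$ and only matters where m + k is
   even; its other values are unconstrained. *)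
Definition on_grid (k : nat) (m : int) : bool := (2 %| m + k%:Z)%Z.

Definition LF_initial (N : nat) (u0 : R -> R) (u : nat -> int -> R) : Prop :=
  let dx := mesh N in
  forall m : int, on_grid 0 m ->
    u 0%N m = (2 * dx)^-1 *
      \int[lebesgue_measure]_(y in `[node dx m - dx, node dx m + dx]) u0 y.

Definition LF_periodic (N : nat) (u : nat -> int -> R) : Prop :=
  forall (k : nat) (m : int), on_grid k m ->
    u k (m + (2 * N)%:Z) = u k m /\ u k (m - (2 * N)%:Z) = u k m.

Definition LF_step (H : R -> R -> R -> R) (N K : nat) (c : R)
    (u : nat -> int -> R) : Prop :=
  let dx := mesh N in let dt := mesh K in
  forall (k : nat) (m : int), on_grid k m ->
    (u k.+1 (m + 1) - (u k m + u k (m + 2)) / 2) / dt +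
    (H (node dx (m + 2)) (node dt k) (c + u k (m + 2)) -
     H (node dx m) (node dt k) (c + u k m)) / (2 * dx) = 0.

Definition LF_solution (H : R -> R -> R -> R) (N K : nat) (c : R)
    (u0 : R -> R) (u : nat -> int -> R) : Prop :=
  [/\ LF_initial N u0 u, LF_periodic N u & LF_step H N K c u].

End lax_friedrichs.

(* Main.v *)
Require Import Defs.
From mathcomp Require Import all_boot all_order all_algebra.
From mathcomp Require Import all_classical all_reals all_analysis.
From mathcomp Require Import measurable_realfun ess_sup_inf.
From mathcomp Require Import ring lra.
Import Order.TTheory GRing.Theory Num.Theory.
Import numFieldNormedType.Exports.
Local Open Scope classical_set_scope.
Local Open Scope ring_scope.

Set Implicit Arguments.
Unset Strict Implicit.
Unset Printing Implicit Defensive.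

(** The solution of the scheme is bounded by a stochastic control argument which
    is uniform in time.

    Value function.  As u has mean zero at time 0, it is the spatial difference
    of a periodic v, and v can be evolved by a discrete Hamilton-Jacobi scheme
    so that u remains its difference ([slope_HJ_iterate]).  With the convexity
    of H, each step of this scheme is an optimal control step:
    v(k+1) is the infimum over xi of the average of v(k) at the two neighbours
    with weights (1 + lambda * xi) / 2 and (1 - lambda * xi) / 2, plus dt times
    a running cost.  As long as |lambda * Hp| <= 1 along the solution, these
    weights are probabilities and v is the expected cost of a random walk.

    Growth of the slope.  Moving the walk by one node shows that the slope grows
    along it at most at rate |H_x|.  The envelope theorem for the Legendre
    transform ([legendre_xE]) and the growth condition on L_x bound |H_x| by
    the running cost, up to constants ([running_cost_bounds]).  The running
    cost in turn is paid by v: its expected total over one unit of time is a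
    variation of v, which is bounded by a constant.  So u grows by a bounded
    amount in one unit of time.

    Uniformity in time.  Two facts make the bounds at the end of a unit of time
    no worse than at its start.
    - The oscillation of v is forgotten: a constant drift reaches any point of
      the torus in one unit of time, up to the fluctuation sqrt(dx / lambda) of
      the walk, which is harmless for small dx because lambda >= lambda0
      ([value_osc_final]).
    - The slope is forgotten.  Where it exceeds M, the running cost exceeds a
      large constant Th ([running_cost_large]), and since the total cost is
      bounded the walk can only stay there for a small fraction of the time.
      Where it is below M, one step of the walk sees that small slope with
      probability at least 1/4.  Both effects are captured by the decrease of
      u - B * v with B = A + K * R0 ([slope_step_decay]); it brings an initial
      bound R0, chosen large against M and C1, back to R0 after one unit of
      time ([slope_le_final]).
    Hence |u| <= Rb for all times ([slope_bounded_forever]), where Rb does not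
    depend on the mesh.  The constant lambda1 is chosen so that the CFL
    condition holds with a margin for all slopes up to Rb; the induction on
    the time step is closed because each step only needs the condition at the
    previous ones. *)

Lemma periodicz (V : zmodType) (T : Type) (f : V -> T) (a : V) :
  (forall x, f (x + a) = f x) -> forall x (n : int), f (x + a *~ n) = f x.
Proof.
move=> fa x; elim/int_ind => [|n ih|n ih]; first by rewrite mulr0z addr0.
  by rewrite -ih -[RHS]fa intS mulrzDr mulr1z addrA addrAC.
by rewrite -ih -[LHS]fa intS opprD mulrzDr mulrN1z addrA addrAC subrK.
Qed.

(** * The discrete Hamilton-Jacobi scheme *)

Section scheme.
Context {R : realFieldType}.
Implicit Types (v : nat -> int -> R) (h hp g : nat -> int -> R -> R).

Definition slope (dx : R) v (k : nat) (j : int) : R :=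
  (v k (j + 1) - v k j) / (2 * dx).

(** The index [j] at time [k] stands for the node of abscissa
    (2 * j + k - 1) * dx, so the staggered grid needs no parity condition: both
    neighbours of the node (k.+1, j) at time k are j and j + 1, and [slope] at
    (k, j) sits at the abscissa (2 * j + k) * dx between them. *)
Definition HJ_step (dx dt c : R) h v : Prop :=
  forall k j, v k.+1 j =
    (v k j + v k (j + 1)) / 2 - dt * h k j (c + slope dx v k j).

(** Adding a drift to the average of two neighbours yields a weighted average:
    this is one step, backward in time, of a random walk of velocity [xi]. *)
Lemma average_drift (dx lam xi a b : R) : 0 < dx ->
  (a + b) / 2 - lam * dx * (xi * ((b - a) / (2 * dx))) =
  (1 + lam * xi) / 2 * a + (1 - lam * xi) / 2 * b.
Proof. by move=> dx0; field; rewrite gt_eqF. Qed.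

Lemma weights_ge0 (lam xi : R) : 0 <= lam -> lam * `|xi| <= 1 ->
  (0 <= (1 + lam * xi) / 2) && (0 <= (1 - lam * xi) / 2).
Proof.
move=> lam0 h; have : `|lam * xi| <= 1 by rewrite normrM ger0_norm.
by rewrite ler_norml => /andP[? ?]; apply/andP; split; lra.
Qed.

(** By convexity the optimal drift xi = hp costs at least -h(c) per unit of
    time, and under the CFL condition the scheme is then a true average. *)
Lemma value_lower_bound (dx lam c C a : R) h hp v n :
  0 < dx -> 0 <= lam ->
  HJ_step dx (lam * dx) c h v ->
  (forall k j p q, h k j p + hp k j p * (q - p) <= h k j q) ->
  (forall k j, h k j c <= C) ->
  (forall k j, (k < n)%N -> lam * `|hp k j (c + slope dx v k j)| <= 1) ->
  (forall j, a <= v 0%N j) ->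
  forall k, (k <= n)%N -> forall j, a - k%:R * (lam * dx) * C <= v k j.
Proof.
move=> dx0 lam0 st cv hC cfl v0; elim=> [_ j|k IH kn j].
  by have := v0 j; lra.
rewrite st; set u := slope _ _ _ _; set xi := hp k j (c + u).
have /andP[w1 w2] := weights_ge0 lam0 (cfl k j kn).
have hx : h k j (c + u) <= xi * u + C.
  by have := cv k j (c + u) c; have := hC k j; rewrite -/xi; lra.
have {}hx := ler_wpM2l (mulr_ge0 lam0 (ltW dx0)) hx.
have e := average_drift lam xi (v k j) (v k (j + 1)) dx0.
rewrite -/(slope dx v k j) -/u in e.
have := ler_wpM2l w1 (IH (ltnW kn) j).
have := ler_wpM2l w2 (IH (ltnW kn) (j + 1)).
rewrite -/xi in w1 w2 e *; move: w1 w2 e hx; rewrite [k.+1%:R]mulrSr; lra.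
Qed.

(** A control of constant velocity [xi] is suboptimal, whatever the slope of
    [v].  Along its random walk a quadratic is transported with the mean while
    each step adds at most dx ^ 2 of variance. *)
Lemma value_upper_bound (dx lam c C a s xi y : R) h v :
  0 < dx -> 0 <= lam -> 0 <= s -> lam * `|xi| <= 1 ->
  HJ_step dx (lam * dx) c h v ->
  (forall k j p, xi * p - C <= h k j p) ->
  (forall j, v 0%N j <= a + s * (2 * j%:~R * dx - y) ^+ 2) ->
  forall k j, v k j <= a +
    s * (((2 * j%:~R + k%:R) * dx - y - xi * (k%:R * (lam * dx))) ^+ 2 +
         k%:R * dx ^+ 2) +
    k%:R * (lam * dx) * (C - c * xi).
Proof.
move=> dx0 lam0 s0 cfl st hC v0; elim=> [j|k IH j].
  by have := v0 j; rewrite !mul0r mulr0 subr0 !addr0.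
rewrite st; set u := slope _ _ _ _.
have /andP[w1 w2] := weights_ge0 lam0 cfl.
have hx := ler_wpM2l (mulr_ge0 lam0 (ltW dx0)) (hC k j (c + u)).
have e := average_drift lam xi (v k j) (v k (j + 1)) dx0.
rewrite -/(slope dx v k j) -/u in e.
have := ler_wpM2l w1 (IH j); have := ler_wpM2l w2 (IH (j + 1)).
(* the variance of one step is dx ^ 2 - (lam * dx * xi) ^ 2 *)
have : 0 <= s * (lam * dx * xi) ^+ 2 by rewrite mulr_ge0 ?sqr_ge0.
move: e hx; rewrite [k.+1%:R]mulrSr !intrD; clearbody u.
set X := j%:~R; move: (v k _) (v k _) (h _ _ _) => a1 a2 h1.
nra.
Qed.

(** The value and the slope one node further are moved by the same walk.  The
    drift [xi] is the derivative of the flux at the neighbouring node, at the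
    slope [u1] seen by the value: convexity then bounds the increment of the
    slope by the spatial increment of the flux at the fixed momentum [u1],
    that is, by [g], and the value decreases by the running cost
    xi * u1 - h1'. *)
Lemma slope_step (dx lam B g xi u1 u2 vL vR h1 h1' h2' : R) :
  0 < dx -> 0 <= lam -> 0 <= B -> u1 = (vR - vL) / (2 * dx) ->
  h1' + xi * (u2 - u1) <= h2' -> `|h1' - h1| <= 2 * dx * g ->
  2 * dx * B <= 1 ->
  (u1 + u2) / 2 - lam / 2 * (h2' - h1) - B * ((vL + vR) / 2 - lam * dx * h1)
  <= (1 + lam * xi) / 2 * (u1 - B * vL) + (1 - lam * xi) / 2 * (u2 - B * vR)
     + lam * dx * (2 * g - B * (xi * u1 - h1')).
Proof.
move=> dx0 lam0 B0 u1E hc /ler_normlP[hg1 hg2] hB.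
have e := average_drift lam xi vL vR dx0; rewrite -u1E in e.
have dg : 0 <= 2 * dx * g by lra.
have := ler_wpM2l lam0 hc; have := ler_wpM2l lam0 hg1.
have := ler_wpM2l lam0 hg2.
have := ler_wpM2l (mulr_ge0 (mulr_ge0 lam0 (ltW dx0)) B0) hg1.
have := ler_wpM2l (mulr_ge0 lam0 dg) hB.
have : B * ((vL + vR) / 2 - lam * dx * (xi * u1)) =
    B * ((1 + lam * xi) / 2 * vL + (1 - lam * xi) / 2 * vR) by rewrite e.
lra.
Qed.

(** The combination slope - B * value decreases at rate [D].  If the slope [u1]
    exceeds [M], the running cost is at least [Th] and the value pays for the
    decrease.  Otherwise the walk goes with probability at least 1/4 to the
    node of slope [u1], where the combination is at most M + B * C1, hence
    below [z] by 1: this gain of 1/4 in one step exceeds anything of order of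
    the time step. *)
Lemma slope_step_decay
    (dx lam A C K B Th M R0 C1 D g q xi z u1 u2 vL vR h1 h1' h2' : R) :
  0 < dx -> 0 <= lam -> 0 <= A -> 0 <= K -> 0 <= R0 ->
  B = A + K * R0 -> K * Th = 2 -> A * C <= R0 -> D <= R0 ->
  2 * dx * B <= 1 -> 4 * (lam * dx) * (R0 + B * C) <= 1 ->
  lam * `|xi| <= 1 / 2 ->
  u1 = (vR - vL) / (2 * dx) -> `|vL| <= C1 ->
  h1' + xi * (u2 - u1) <= h2' -> `|h1' - h1| <= 2 * dx * g ->
  q = xi * u1 - h1' -> - C <= q -> 2 * g <= A * (q + C) ->
  (M <= u1 -> Th <= q) ->
  u1 - B * vL <= z -> u2 - B * vR <= z -> M + B * C1 + 1 <= z ->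
  (u1 + u2) / 2 - lam / 2 * (h2' - h1) - B * ((vL + vR) / 2 - lam * dx * h1)
  <= z - D * (lam * dx).
Proof.
move=> dx0 lam0 A0 K0 R00 BE KTh AC DR dxB dtB cfl u1E vLC cv hg qE qC gA.
move=> qM z1 z2 zM.
have KR0 : 0 <= K * R0 by rewrite mulr_ge0.
have B0 : 0 <= B by rewrite BE addr_ge0.
apply: le_trans (slope_step dx0 lam0 B0 u1E cv hg dxB) _; rewrite -qE.
have /andP[w1 w2] :
    (1 / 4 <= (1 + lam * xi) / 2) && (0 <= (1 - lam * xi) / 2).
  have : `|lam * xi| <= 1 / 2 by rewrite normrM ger0_norm.
  by rewrite ler_norml => /andP[? ?]; apply/andP; split; lra.
have dt0 : 0 <= lam * dx by rewrite mulr_ge0 // ltW.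
have hw2 := ler_wpM2l w2 z2.
have w1' : 0 <= (1 + lam * xi) / 2 by lra.
case: (leP M u1) => hM.
  have hw1 := ler_wpM2l w1' z1.
  have hq := ler_wpM2l KR0 (qM hM).
  have br : 2 * g - B * q <= - R0.
    rewrite BE mulrDl; have : K * R0 * Th = 2 * R0 by rewrite mulrAC KTh.
    by lra.
  have := ler_wpM2l dt0 br; have := ler_wpM2l dt0 DR.
  lra.
have hv : - (B * vL) <= B * C1.
  rewrite -mulrN ler_wpM2l //; apply: le_trans vLC.
  by rewrite -normrN ler_norm.
have br : 2 * g - B * q <= B * C.
  have := ler_wpM2l KR0 qC; rewrite BE !mulrDl; lra.
have h1z : u1 - B * vL <= z - 1 by lra.
have hw1 := ler_wpM2l w1' h1z.
have := ler_wpM2l dt0 br; have := ler_wpM2l dt0 DR.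
lra.
Qed.

Lemma HJ_periodic (dx dt c : R) h v (per : int) :
  HJ_step dx dt c h v -> (forall k j p, h k (j + per) p = h k j p) ->
  (forall j, v 0%N (j + per) = v 0%N j) ->
  forall k j, v k (j + per) = v k j.
Proof.
move=> step hper v0; elim=> // k ih j.
by rewrite !step /slope hper addrAC !ih.
Qed.

End scheme.

(** * Amplitudes and mesh sizes *)

(** Amplitudes over one unit of time.  At its start the oscillation of the value
    is at most [C0] and the slope at most [R0]; during it the value moves by at
    most [C1] and the slope stays below [Rb].  [A] and [C] bound the forcing of
    the slope by the running cost, and [M] is the slope above which that cost
    exceeds [Th].  The slope is controlled through slope - [B] * value, whose
    weight [B] grows with [R0]: its part [K] * [R0] makes a cost [Th] large
    against [R0], although multiplied by [C1] it remains a fraction of [R0].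
    [Th] is fixed by [C1] alone, then [M] by [Th], and [R0] last. *)
Record amplitude_conditions {R : realFieldType}
    (A C K M Th R0 C0 C1 B Rb : R) : Prop := {
  A_ge0 : 0 <= A;
  K_ge0 : 0 <= K;
  C_ge0 : 0 <= C;
  M_ge0 : 0 <= M;
  C0_ge0 : 0 <= C0;
  C1_def : C1 = C0 + C;
  B_def : B = A + K * R0;
  Rb_def : Rb = R0 + 2 * B * C1;
  K_small : 8 * K * C1 = 1;
  Th_large : K * Th = 2;
  R0_ge_AC : A * C <= R0;
  R0_large : 2 * (M + 1 + 2 * A * C1) <= R0
}.

Record mesh_conditions {R : realFieldType}
    (dx lam C R0 B : R) (n : nat) : Prop := {
  dx_gt0 : 0 < dx;
  lam_ge0 : 0 <= lam;
  lam_le1 : lam <= 1;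
  dx_small : 2 * dx * B <= 1;
  dt_small : 4 * (lam * dx) * (R0 + B * C) <= 1;
  unit_time : n%:R * (lam * dx) = 1;
  diffusion_small : 2 * R0 ^+ 2 * dx <= lam
}.

Lemma amplitudes_exist {R : realFieldType} (A C C0 C1 M r : R) :
  0 <= A -> 0 <= C -> 0 <= C0 -> 0 < C1 -> 0 <= M -> 0 <= r -> C1 = C0 + C ->
  exists R0 B Rb, r <= R0 /\
    amplitude_conditions A C (8 * C1)^-1 M (16 * C1) R0 C0 C1 B Rb.
Proof.
move=> A0 C_0 C00 C10 M0 r0 C1E.
have AC : 0 <= A * C by rewrite mulr_ge0.
have AC1 : 0 <= A * C1 by rewrite mulr_ge0 // ltW.
exists (r + 2 * (M + 1 + 2 * A * C1) + A * C); do 2 eexists.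
split; first by lra.
split=> //; try by [reflexivity | lra].
- by rewrite invr_ge0; lra.
- by field; rewrite gt_eqF.
- by field; rewrite gt_eqF.
Qed.

Lemma fine_mesh_exists {R : realFieldType} (C R0 B lam0 e : R) :
  0 <= C -> 0 <= R0 -> 0 <= B -> 0 < lam0 -> 0 < e ->
  exists2 delta, 0 < delta & forall dx lam n,
    0 < dx -> dx <= delta -> lam0 <= lam -> lam <= 1 ->
    n%:R * (lam * dx) = 1 ->
    dx <= e /\ mesh_conditions dx lam C R0 B n.
Proof.
move=> C_0 R00 B0 lam00 e0.
have RBC : 0 <= R0 + B * C by rewrite addr_ge0 ?mulr_ge0.
have R0s : 0 <= R0 ^+ 2 by rewrite sqr_ge0.
pose b1 := (2 * B + 1)^-1; pose b2 := (4 * (R0 + B * C) + 1)^-1.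
pose b3 := lam0 / (2 * R0 ^+ 2 + 1).
exists (Num.min (Num.min e b1) (Num.min b2 b3)).
  rewrite !lt_min e0 /b1 /b2 /b3 divr_gt0 ?invr_gt0 //=; last by lra.
  by apply/andP; split; lra.
move=> dx lam n dx0; rewrite !le_min => /andP[/andP[-> dx1] /andP[dx2 dx3]].
move=> lam0_le lam1 n1; split => //.
have {dx1} h1 : dx * (2 * B + 1) <= 1.
  by move: dx1; rewrite /b1 -[X in _ <= X]div1r ler_pdivlMr //; lra.
have {dx2} h2 : dx * (4 * (R0 + B * C) + 1) <= 1.
  by move: dx2; rewrite /b2 -[X in _ <= X]div1r ler_pdivlMr //; lra.
have {dx3} h3 : dx * (2 * R0 ^+ 2 + 1) <= lam0.
  by move: dx3; rewrite /b3 ler_pdivlMr //; lra.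
have lam_0 : 0 <= lam by lra.
split=> //; try by lra.
by have := ler_wpM2r RBC (ler_wpM2r (ltW dx0) lam1); rewrite mul1r; lra.
Qed.

(** * One unit of time *)

(** [c] is the mean slope: the momentum [p] is [c] plus a slope.  [hp] is the
    derivative of [h] in the momentum, [g] bounds its spatial increments, and
    (p - c) * hp - h is the running cost.  The last two bounds depend on
    the mesh and can only hold for bounded slopes. *)
Record flux_bounds {R : realFieldType} (dx lam c C A M Th Rb : R)
    (h hp g : nat -> int -> R -> R) : Prop := {
  flux_convex : forall k j p p', h k j p + hp k j p * (p' - p) <= h k j p';
  flux_le_at : forall k j, h k j c <= C;
  flux_coercive : forall k j p, `|p| - C <= h k j p;
  cost_large : forall k j p,
    M <= `|p - c| -> Th <= (p - c) * hp k j p - h k j p;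
  increment_le_cost : forall k j p,
    2 * g k j p <= A * ((p - c) * hp k j p - h k j p + C);
  flux_increment : forall k j j' p, `|p - c| <= Rb ->
    j' = j + 1 \/ j' = j - 1 -> `|h k j' p - h k j p| <= 2 * dx * g k j' p;
  CFL : forall k j p, `|p - c| <= Rb -> lam * `|hp k j p| <= 1 / 2
}.

Section unit_time_block.
Context {R : realFieldType} (dx lam c C A K M Th R0 C0 C1 B Rb : R) (n : nat).
Context (h hp g : nat -> int -> R -> R) (v : nat -> int -> R).
Local Notation dt := (lam * dx).
Local Notation q k j p := ((p - c) * hp k j p - h k j p).
Local Notation u := (slope dx v).
Local Notation D := (R0 - M - 1).
Local Notation barrier k := (R0 + B * C1 - D * (k%:R * dt)).

Hypothesis amps : amplitude_conditions A C K M Th R0 C0 C1 B Rb.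
Hypothesis grid : mesh_conditions dx lam C R0 B n.
Hypothesis flux : flux_bounds dx lam c C A M Th Rb h hp g.
Hypothesis step : HJ_step dx dt c h v.
Hypothesis osc0 : forall j j', v 0%N j - v 0%N j' <= C0.
Hypothesis u0 : forall j, `|u 0%N j| <= R0.

Let dx0 := dx_gt0 grid.
Let lam0 := lam_ge0 grid.
Let n1 := unit_time grid.
Let A0 := A_ge0 amps.
Let K0 := K_ge0 amps.
Let C_nneg := C_ge0 amps.
Let M0 := M_ge0 amps.
Let C00 := C0_ge0 amps.
Let C1E := C1_def amps.
Let BE := B_def amps.
Let RbE := Rb_def amps.
Let R0_lb := R0_large amps.
Let convex := flux_convex flux.
Let cfl := CFL flux.

Lemma dt_ge0 : 0 <= dt. Proof. by rewrite mulr_ge0 ?lam0 // ltW ?dx0. Qed.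

Lemma C1_ge0 : 0 <= C1. Proof. by rewrite C1E addr_ge0 ?C00 ?C_nneg. Qed.

Lemma AC1_ge0 : 0 <= A * C1. Proof. by rewrite mulr_ge0 ?A0 ?C1_ge0. Qed.

Lemma R0_ge0 : 0 <= R0. Proof. by move: AC1_ge0 M0 R0_lb; lra. Qed.

Lemma KR0_ge0 : 0 <= K * R0. Proof. by rewrite mulr_ge0 ?K0 ?R0_ge0. Qed.

Lemma B_ge0 : 0 <= B. Proof. by rewrite BE addr_ge0 ?A0 ?KR0_ge0. Qed.

Lemma BC1_ge0 : 0 <= B * C1. Proof. by rewrite mulr_ge0 ?B_ge0 ?C1_ge0. Qed.

Lemma BC1E : B * C1 = A * C1 + R0 / 8.
Proof.
have : 8 * K * C1 * R0 = R0 by rewrite (K_small amps) mul1r.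
by rewrite BE; lra.
Qed.

Lemma decay_rate_ge0 : 0 <= D.
Proof. by move: AC1_ge0 M0 R0_lb; lra. Qed.

Lemma elapsed_le1 k : (k <= n)%N -> 0 <= k%:R * dt <= 1.
Proof.
move=> kn; rewrite mulr_ge0 ?ler0n ?dt_ge0 //= -[leRHS]n1.
by rewrite ler_wpM2r ?dt_ge0 // ler_nat.
Qed.

(** Fenchel: the running cost is at least that of the momentum [c]. *)
Lemma cost_ge k j p : - C <= q k j p.
Proof. by have := convex k j p c; have := flux_le_at flux k j; lra. Qed.

Lemma value_deviation k : (k <= n)%N ->
  (forall i j, (i < k)%N -> `|u i j| <= Rb) ->
  forall j, `|v k j - v 0%N 0| <= C1.
Proof.
move=> kn uj j; have /andP[k0 k1] := elapsed_le1 kn.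
have lo : v 0%N 0 - C0 - k%:R * dt * C <= v k j.
  apply: (value_lower_bound dx0 lam0 step convex (flux_le_at flux) (n := k))
    => // [i l ik|l].
    apply: le_trans (_ : 1 / 2 <= 1); last by lra.
    by apply: cfl; rewrite addrAC subrr add0r uj.
  by have := osc0 0 l; lra.
have up : v k j <= v 0%N 0 + C0 + k%:R * dt * C.
  (* the walk without drift *)
  have := @value_upper_bound _ dx lam c C (v 0%N 0 + C0) 0 0 0 h v dx0 lam0.
  move=> /(_ (lexx _)); rewrite normr0 mulr0 ler01 => /(_ isT step) ub.
  have := ub _ _ k j; rewrite !mul0r addr0 mulr0 subr0; apply.
    move=> i l p; have := flux_coercive flux i l p.
    by have := normr_ge0 p; lra.
  by move=> l; rewrite mul0r addr0; have := osc0 l 0; lra.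
have := ler_wpM2r C_nneg k1; rewrite ler_norml C1E => kC.
by apply/andP; split; lra.
Qed.

Lemma slope_of_combination k : (k <= n)%N ->
  (forall j, `|v k j - v 0%N 0| <= C1) ->
  (forall j, u k j - B * (v k j - v 0%N 0) <= barrier k /\
             - u k (j - 1) - B * (v k j - v 0%N 0) <= barrier k) ->
  forall j, `|u k j| <= barrier k + B * C1.
Proof.
move=> kn vb ub j.
have vB i : `|B * (v k i - v 0%N 0)| <= B * C1.
  by rewrite normrM (ger0_norm B_ge0) ler_wpM2l ?B_ge0.
have := vB j; have := vB (j + 1).
have [+ _] := ub j; have [_ +] := ub (j + 1).
rewrite addrK !ler_norml => ? ? /andP[? ?] /andP[? ?].
by apply/andP; split; lra.
Qed.

Lemma barrier_bounds k : (k <= n)%N ->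
  M + 1 + B * C1 <= barrier k <= R0 + B * C1.
Proof.
move=> /elapsed_le1 /andP[k0 k1].
have := mulr_ge0 decay_rate_ge0 k0.
have : D * (k%:R * dt) <= R0 - M - 1.
  by rewrite -[leRHS]mulr1 (ler_wpM2l decay_rate_ge0).
by lra.
Qed.

(** Upper bounds of the slope come from comparing each value with its right
    neighbour, lower bounds from its left neighbour; the second case is the
    mirror image of the first, with the signs of slope and drift reversed. *)
Lemma slope_below_barrier k : (k <= n)%N ->
  forall j, u k j - B * (v k j - v 0%N 0) <= barrier k /\
             - u k (j - 1) - B * (v k j - v 0%N 0) <= barrier k.
Proof.
elim/ltn_ind: k => -[_ _ j|k IH kn].
  have vB : `|B * (v 0%N j - v 0%N 0)| <= B * C1.
    rewrite normrM (ger0_norm B_ge0) ler_wpM2l ?B_ge0 // ler_norml C1E.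
    have := osc0 j 0; have := osc0 0 j; move: C_nneg => ? ? ?.
    by apply/andP; split; lra.
  rewrite mul0r mulr0 subr0; move: vB; rewrite ler_norml => /andP[? ?].
  have := BC1_ge0; have := u0 j; have := u0 (j - 1).
  by rewrite !ler_norml => /andP[? ?] /andP[? ?]; split; lra.
have ub i j : (i <= k)%N -> `|u i j| <= Rb.
  elim/ltn_ind: i j => i IHi j ik.
  have i_n : (i <= n)%N by rewrite (leq_trans ik) // ltnW.
  apply: le_trans (slope_of_combination i_n _ (IH i _ i_n) j) _ => //.
    apply: value_deviation => // l l' li; apply: IHi => //.
    exact: leq_trans (ltnW li) ik.
  by have /andP[_ ?] := barrier_bounds i_n; rewrite RbE; lra.
pose w j := v k j - v 0%N 0.
have wC j : `|w j| <= C1.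
  by apply: value_deviation => [|i l ik]; [exact: ltnW|apply: ub; exact: ltnW].
have barrierS : barrier k.+1 = barrier k - D * dt.
  by rewrite [k.+1%:R]mulrSr; ring.
have /andP[barrier_ge _] := barrier_bounds (ltnW kn).
have cu j : c + u k j - c = u k j by rewrite addrAC subrr add0r.
have DR : D <= R0 by move: M0; lra.
have wE j : v k.+1 j - v 0%N 0 =
    (w j + w (j + 1)) / 2 - dt * h k j (c + u k j).
  by rewrite step /w; field.
have wE' j : v k.+1 j - v 0%N 0 =
    (w (j + 1) + w j) / 2 - dt * h k j (c + u k j).
  by rewrite wE [w _ + _]addrC.
have uE j : u k.+1 j = (u k j + u k (j + 1)) / 2 -
    lam / 2 * (h k (j + 1) (c + u k (j + 1)) - h k j (c + u k j)).
  rewrite {1}/slope !step; move: (h k (j + 1) _) (h k j _) => h1 h2.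
  by rewrite /slope; field; rewrite gt_eqF.
move=> j; split; rewrite barrierS uE.
  rewrite wE.
  apply: (slope_step_decay dx0 lam0 A0 K0 R0_ge0 BE (Th_large amps)
      (R0_ge_AC amps) DR (dx_small grid) (dt_small grid) (M := M) (C1 := C1)
      (xi := hp k (j + 1) (c + u k j)) (h1' := h k (j + 1) (c + u k j))
      (g := g k (j + 1) (c + u k j)) (q := q k (j + 1) (c + u k j))) => //.
  - by apply: cfl; rewrite cu ub.
  - by rewrite /w opprB addrA subrK.
  - have := convex k (j + 1) (c + u k j) (c + u k (j + 1)).
    by rewrite opprD addrACA subrr add0r.
  - by apply: (flux_increment flux); [rewrite cu ub|left].
  - by rewrite cu mulrC.
  - exact: cost_ge.
  - exact: (increment_le_cost flux).
  - by move=> Mu; apply: (cost_large flux); rewrite cu (le_trans Mu) ?ler_norm.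
  - by have [+ _] := IH k (ltnSn k) (ltnW kn) j.
  - by have [+ _] := IH k (ltnSn k) (ltnW kn) (j + 1).
  - by rewrite addrAC.
rewrite wE' subrK.
rewrite (_ : - (_ - _) = (- u k j + - u k (j - 1)) / 2 -
    lam / 2 * (h k (j - 1) (c + u k (j - 1)) - h k j (c + u k j))); last first.
  by field.
apply: (slope_step_decay dx0 lam0 A0 K0 R0_ge0 BE (Th_large amps)
    (R0_ge_AC amps) DR (dx_small grid) (dt_small grid) (M := M) (C1 := C1)
    (xi := - hp k (j - 1) (c + u k j)) (h1' := h k (j - 1) (c + u k j))
    (g := g k (j - 1) (c + u k j)) (q := q k (j - 1) (c + u k j))) => //.
- by rewrite normrN; apply: cfl; rewrite cu ub.
- by rewrite /w /slope; field; rewrite gt_eqF.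
- by have := convex k (j - 1) (c + u k j) (c + u k (j - 1)); lra.
- by apply: (flux_increment flux); [rewrite cu ub|right].
- by rewrite cu mulrNN mulrC.
- exact: cost_ge.
- exact: (increment_le_cost flux).
- move=> Mu; apply: (cost_large flux); rewrite cu (le_trans Mu) //.
  by rewrite -normrN ler_norm.
- by have [_ +] := IH k (ltnSn k) (ltnW kn) (j + 1); rewrite addrK.
- by have [_ +] := IH k (ltnSn k) (ltnW kn) j.
- by rewrite addrAC.
Qed.

Lemma slope_le k j : (k <= n)%N -> `|u k j| <= barrier k + B * C1.
Proof.
elim/ltn_ind: k j => k IH j kn.
apply: slope_of_combination (slope_below_barrier kn) j => //.
apply: value_deviation => // i l ik; have i_n := leq_trans (ltnW ik) kn.
have := IH i ik l i_n; have /andP[_ ?] := barrier_bounds i_n.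
by rewrite RbE; lra.
Qed.

Lemma slope_le_uniform k j : (k <= n)%N -> `|u k j| <= Rb.
Proof.
move=> kn; have := slope_le j kn; have /andP[_ ?] := barrier_bounds kn.
by rewrite RbE; lra.
Qed.

(** After one unit of time the barrier is at M + 1 + B * C1, and 2 * B * C1 is
    2 * A * C1 + R0 / 4: the initial bound is recovered. *)
Lemma slope_le_final j : `|u n j| <= R0.
Proof.
have := slope_le j (leqnn n); rewrite n1.
by move: BC1E R0_ge0 R0_lb; lra.
Qed.

Lemma value_lipschitz i j :
  `|v 0%N j - v 0%N i| <= R0 * (2 * `|j%:~R - i%:~R| * dx).
Proof.
have nat_case l (d : nat) :
    `|v 0%N (l + d%:Z) - v 0%N l| <= R0 * (2 * d%:R * dx).
  elim: d => [|d ih]; first by rewrite addr0 subrr normr0 mulr0 mul0r mulr0.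
  have -> : v 0%N (l + d.+1%:Z) - v 0%N l =
      2 * dx * u 0%N (l + d%:Z) + (v 0%N (l + d%:Z) - v 0%N l).
    have -> : l + d.+1%:Z = l + d%:Z + 1 by rewrite -addn1 PoszD addrA.
    by rewrite /slope mulrC divfK ?subrKA // mulf_neq0 // gt_eqF.
  apply: le_trans (ler_normD _ _) _.
  rewrite normrM ger0_norm ?mulr_ge0 ?(ltW dx0) //.
  have := ler_wpM2l (ltW dx0) (u0 (l + d%:Z)).
  by move: ih; rewrite [d.+1%:R]mulrSr; lra.
wlog ij : i j / i <= j => [hw|].
  have [|ji] := boolP (i <= j); first exact: hw.
  by rewrite distrC (distrC j%:~R); apply: hw; rewrite ltW // ltNge.
have [d dE] : exists d : nat, j = i + d%:Z.
  by exists `|j - i|%N; rewrite gez0_abs ?subr_ge0 // addrCA subrr addr0.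
have -> : `|j%:~R - i%:~R| = d%:R :> R.
  by rewrite dE intrD addrAC subrr add0r ger0_norm ?ler0z.
by rewrite dE; exact: nat_case.
Qed.

(** In one unit of time a drift of velocity at most 1 leads from any node to
    any other one of the torus, so that the final oscillation does not remember
    the initial one.  The random walk misses its target by a standard deviation
    of order sqrt(dx / lam); as the value is Lipschitz, a fine mesh makes this
    error at most 1. *)
Lemma value_osc_final (per half : nat) :
  (0 < per)%N -> n = (2 * half)%N -> 2 * per%:R * dx = 1 ->
  (forall j, v 0%N (j + per%:Z) = v 0%N j) ->
  2 * C + `|c| + 1 <= C0 ->
  forall j j', v n j - v n j' <= C0.
Proof.
move=> per0 n_half perdx vper C0_lb j j'.
have up i0 : v n j - (C + `|c| + 1) <= v 0%N i0.
  (* i is the translate of i0 reached from j with a velocity xi in [0, 1] *)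
  have := divz_eq (j + half%:Z - i0) per%:Z.
  set d := divz _ _; set e := modz _ _ => E0.
  have e0 : 0 <= e by rewrite modz_ge0 // gt_eqF // ltz_nat.
  have e1 : e <= per%:Z by rewrite ltW // ltz_pmod // ltz_nat.
  rewrite -(periodicz vper i0 d); set i := i0 + _.
  have je : j + half%:Z = i + e.
    by rewrite /i mulrzz mulrC -addrA -E0 addrCA subrr addr0.
  set xi : R := 2 * e%:~R * dx.
  have xi0 : 0 <= xi by rewrite !mulr_ge0 ?ler0z // ltW.
  have xi1 : xi <= 1.
    rewrite -perdx ler_wpM2r ?(ltW dx0) // ler_wpM2l //.
    by rewrite -[per%:R]/(per%:Z%:~R) ler_int.
  have := @value_upper_bound _ dx lam c C (v 0%N i + 1 / 2) (R0 ^+ 2 / 2) xi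
    (2 * i%:~R * dx) h v dx0 lam0.
  have s0 : 0 <= R0 ^+ 2 / 2 by rewrite divr_ge0 ?sqr_ge0.
  have cf : lam * `|xi| <= 1 by rewrite ger0_norm // mulr_ile1 ?(lam_le1 grid).
  have hlow k l p : xi * p - C <= h k l p.
    apply: le_trans (flux_coercive flux k l p); rewrite lerD2r.
    apply: le_trans (ler_norm _) _.
    by rewrite normrM (ger0_norm xi0) ler_piMl.
  move=> /(_ s0 cf step hlow) ub.
  have {ub} := ub _ n j.
  have jR : j%:~R + half%:R = i%:~R + e%:~R :> R.
    by rewrite -[half%:R]/(half%:Z%:~R) -!intrD je.
  have -> : (2 * j%:~R + n%:R) * dx - 2 * i%:~R * dx - xi * (n%:R * dt) = 0.
    by rewrite n1 n_half natrM -mulrDr jR /xi; ring.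
  have ndx : R0 ^+ 2 / 2 * (n%:R * dx ^+ 2) <= 1 / 4.
    have l1 := ler_wpM2l (ler0n R n)
      (ler_wpM2r (ltW dx0) (diffusion_small grid)).
    by move: l1 n1; lra.
  rewrite n1 expr0n /= add0r => ub.
  have cxi : - (c * xi) <= `|c|.
    rewrite -mulNr; apply: le_trans (ler_norm _) _.
    by rewrite normrM normrN (ger0_norm xi0) ler_piMr.
  suff : v n j <= v 0%N i + 1 / 2 + R0 ^+ 2 / 2 * (n%:R * dx ^+ 2) +
      1 * (C - c * xi) by lra.
  apply: ub => l; have := le_trans (ler_norm _) (value_lipschitz i l).
  have -> : 2 * l%:~R * dx - 2 * i%:~R * dx = 2 * (l%:~R - i%:~R) * dx by ring.
  have -> : 2 * `|l%:~R - i%:~R| * dx = `|2 * (l%:~R - i%:~R) * dx|.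
    by rewrite !normrM (ger0_norm (ltW dx0)) (ger0_norm (_ : 0 <= 2)).
  (* t <= 1 / 2 + t ^ 2 / 2 turns the Lipschitz bound into a quadratic one *)
  move: (_ * dx) => y; rewrite -(real_normK (num_real y)).
  by have := sqr_ge0 (R0 * `|y| - 1); nra.
have cf k l : (k < n)%N -> lam * `|hp k l (c + u k l)| <= 1.
  move=> kn; apply: le_trans (_ : 1 / 2 <= 1); last by lra.
  by apply: cfl; rewrite addrAC subrr add0r slope_le_uniform // ltnW.
have := value_lower_bound dx0 lam0 step convex (flux_le_at flux) cf up
  (leqnn n) j'.
by rewrite n1; move: C0_lb; lra.
Qed.
End unit_time_block.

(** The bounds on slope and oscillation at the start of a unit of time are
    recovered at its end, so they can be iterated. *)
Lemma slope_bounded_forever {R : realFieldType}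
    (dx lam c C A K M Th R0 C0 C1 B Rb : R) (per half : nat) h hp g v :
  amplitude_conditions A C K M Th R0 C0 C1 B Rb ->
  mesh_conditions dx lam C R0 B (2 * half)%N ->
  flux_bounds dx lam c C A M Th Rb h hp g ->
  HJ_step dx (lam * dx) c h v ->
  2 * C + `|c| + 1 <= C0 ->
  (0 < per)%N -> 2 * per%:R * dx = 1 ->
  (forall k j p, h k (j + per%:Z) p = h k j p) ->
  (forall j, v 0%N (j + per%:Z) = v 0%N j) ->
  (forall j j', v 0%N j - v 0%N j' <= C0) ->
  (forall j, `|slope dx v 0 j| <= R0) ->
  forall k j, `|slope dx v k j| <= Rb.
Proof.
move=> amps grid flux step C0_lb per0 perdx hper vper0 osc0 u0 k j.
set n := (2 * half)%N in grid.
have vper := HJ_periodic step hper vper0.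
have flux_shift k0 : flux_bounds dx lam c C A M Th Rb (fun k => h (k + k0)%N)
    (fun k => hp (k + k0)%N) (fun k => g (k + k0)%N).
  by case: flux => *; split=> *; auto.
have step_shift k0 : HJ_step dx (lam * dx) c (fun k => h (k + k0)%N)
    (fun k => v (k + k0)%N).
  by move=> i l; exact: step.
have n_gt0 : (0 < n)%N.
  case: n grid => // /unit_time; rewrite mul0r => /eqP.
  by rewrite eq_sym oner_eq0.
have start i : (forall l l', v (i * n)%N l - v (i * n)%N l' <= C0) /\
    (forall l, `|slope dx v (i * n) l| <= R0).
  elim: i => // i [osc_i u_i]; rewrite mulSn; split=> l.
    exact: (value_osc_final amps grid (flux_shift _) (step_shift (i * n)%N)
      osc_i u_i per0).
  exact: (slope_le_final amps grid (flux_shift _) (step_shift (i * n)%N)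
    osc_i u_i).
have [osc_k u_k] := start (k %/ n)%N.
have := slope_le_uniform amps grid (flux_shift _) (step_shift _) osc_k u_k j
  (ltnW (ltn_pmod k n_gt0)).
by rewrite /slope [(_ %% _ + _)%N]addnC -divn_eq.
Qed.

(** * Partial derivatives and uniformity over the torus *)

Section partial_derivatives.
Context {R : realType} (f : R * R * R -> R).
Implicit Types z : R * R * R.

Definition partial_x z : R := derive1 (fun y => f (y, z.1.2, z.2)) z.1.1.
Definition partial_p z : R := derive1 (fun p => f (z.1, p)) z.2.

Lemma quotient_x z :
  (fun h : R => h^-1 *: (f (h + z.1.1, z.1.2, z.2) - f (z.1.1, z.1.2, z.2))) =
  (fun h : R => h^-1 *: ((f \o shift z) (h *: ((1, 0, 0) : R * R * R)) - f z)).
Proof.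
apply/funext => h; case: z => [[x t] p] /=; congr (_ *: (f _ - _)).
rewrite /shift (_ : _ + _ = (h * 1 + x, h * 0 + t, h * 0 + p)) //.
by rewrite !mulr0 mulr1 !add0r.
Qed.

Lemma quotient_p z :
  (fun h : R => h^-1 *: (f (z.1, h + z.2) - f (z.1, z.2))) =
  (fun h : R => h^-1 *: ((f \o shift z) (h *: ((0, 0, 1) : R * R * R)) - f z)).
Proof.
apply/funext => h; case: z => [[x t] p] /=; congr (_ *: (f _ - _)).
rewrite /shift (_ : _ + _ = (h * 0 + x, h * 0 + t, h * 1 + p)) //.
by rewrite !mulr0 mulr1 !add0r.
Qed.

Lemma partial_xE z : partial_x z = 'D_((1, 0, 0) : R * R * R) f z.
Proof. by rewrite /partial_x /derive1 /derive quotient_x. Qed.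

Lemma partial_pE z : partial_p z = 'D_((0, 0, 1) : R * R * R) f z.
Proof. by rewrite /partial_p /derive1 /derive quotient_p. Qed.

Hypothesis df : forall z, differentiable f z.

Lemma derivable_x t p x : derivable (fun y => f (y, t, p)) x 1.
Proof.
have := @diff_derivable _ _ _ f (x, t, p) (1, 0, 0) (df _).
rewrite /derivable -quotient_x.
rewrite (_ : (fun h : R => h^-1 *:
    (((fun y => f (y, t, p)) \o shift x) (h *: 1) - f (x, t, p))) =
  (fun h : R => h^-1 *: (f (h + x, t, p) - f (x, t, p)))) //.
by apply/funext => h /=; rewrite /GRing.scale /= mulr1.
Qed.

Lemma derivable_p a p : derivable (fun y => f (a, y)) p 1.
Proof.
have := @diff_derivable _ _ _ f (a, p) (0, 0, 1) (df _).
rewrite /derivable -quotient_p.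
rewrite (_ : (fun h : R => h^-1 *:
    (((fun y => f (a, y)) \o shift p) (h *: 1) - f (a, p))) =
  (fun h : R => h^-1 *: (f (a, h + p) - f (a, p)))) //.
by apply/funext => h /=; rewrite /GRing.scale /= mulr1.
Qed.
End partial_derivatives.

Lemma near_prod (T I : Type) (F : set_system T) (G : set_system I)
    (A : set T) (B : set I) (Q : I -> T -> Prop) :
  F A -> G B -> (forall a b, A a -> B b -> Q b a) ->
  \forall a \near F & b \near G, Q b a.
Proof.
by move=> FA GB AB; exists (A, B) => // -[a b] /= [Aa Bb]; exact: AB.
Qed.

Section torus.
Context {R : realType}.

Lemma mean_value (f : R -> R) a b : (forall x, derivable f x 1) ->
  exists2 c, Num.min a b <= c <= Num.max a b &
    f b - f a = derive1 f c * (b - a).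
Proof.
move=> df.
have cf : continuous f.
  by move=> x; apply/differentiable_continuous/derivable1_diffP.
have df' (x : R) : is_derive x 1 f (derive1 f x).
  by rewrite derive1E; exact/derivableP.
wlog ab : a b / a <= b => [hw|].
  have [|ba] := boolP (a <= b); first exact: hw.
  have {ba} ba : b <= a by rewrite ltW // ltNge.
  have [c] := hw _ _ ba; rewrite minC maxC => cab e; exists c => //.
  by rewrite -opprB e -mulrN opprB.
have [c] := @MVT_segment _ f (derive1 f) a b ab (fun x _ => df' x)
  (continuous_subspaceT cf).
by rewrite in_itv /= => ? ?; exists c; rewrite ?(min_idPl ab) ?(max_idPr ab).
Qed.

Lemma between_dist (a b c : R) : Num.min a b <= c <= Num.max a b ->
  `|c - a| <= `|b - a|.
Proof.
case: (leP a b) => [ab|/ltW ab] /andP[h1 h2].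
  by rewrite !ger0_norm ?subr_ge0 // lerD2r.
by rewrite !ler0_norm ?subr_le0 // lerN2 lerD2r.
Qed.

(** Compactness of [0, 1] x [0, 1] x [-P, P], in the form: a property that
    holds locally for a large (or small) enough parameter holds with one
    parameter for all x and t. *)
Lemma uniform_on_torus (I : Type) (G : set_system I)
    (Q : I -> R * R * R -> Prop) (P : R) :
  Filter G ->
  (forall i x t p, Q i (x + 1, t, p) = Q i (x, t, p)) ->
  (forall i x t p, Q i (x, t + 1, p) = Q i (x, t, p)) ->
  (forall z : R * R * R, \forall z' \near z & i \near G, Q i z') ->
  \forall i \near G, forall x t p, `|p| <= P -> Q i (x, t, p).
Proof.
move=> FG Qx Qt cov.
have I01 := @segment_compact R 0 1.
have /compact_near_coveringP/(_ I G Q FG) nc :=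
  compact_setX (compact_setX I01 I01) (@segment_compact R (- P) P).
have := nc (fun z _ => cov z).
apply: filterS => i Qi x t p pP.
rewrite -(subrK (Num.floor x)%:~R x).
rewrite (periodicz (f := fun y => Q i (y, t, p))) //.
rewrite -(subrK (Num.floor t)%:~R t).
rewrite (periodicz (f := fun y => Q i (_, y, p))) //.
have fl (y : R) : 0 <= y - (Num.floor y)%:~R <= 1.
  by have := floor_itv y; rewrite intrD => /andP[? ?]; apply/andP; split; lra.
apply: Qi; split => /=; first split => /=; rewrite in_itv /= ?fl //.
by rewrite -ler_norml.
Qed.

Lemma torus_bounded (g : R * R * R -> R) (P : R) : continuous g ->
  (forall x t p, g (x + 1, t, p) = g (x, t, p)) ->
  (forall x t p, g (x, t + 1, p) = g (x, t, p)) ->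
  exists2 C : R, 0 <= C & forall x t p, `|p| <= P -> `|g (x, t, p)| <= C.
Proof.
move=> cg gx gt.
have hC : \forall C \near (pinfty_nbhs R),
    forall x t p, `|p| <= P -> `|g (x, t, p)| <= C.
  apply: (@uniform_on_torus _ _ (fun C z => `|g z| <= C)).
  - by move=> C x t p; rewrite gx.
  - by move=> C x t p; rewrite gt.
  move=> z; exists ([set z' | `|g z - g z'| <= 1], [set C | `|g z| + 1 <= C]).
    split => /=; first by move/cvgrPdist_le : (cg z); apply.
    by apply: nbhs_pinfty_ge; exact: num_real.
  move=> [z' C] [/= z1 zC].
  rewrite -(subKr (g z) (g z')); apply: le_trans (ler_normB _ _) _.
  by apply: le_trans zC; rewrite lerD2l.
have [C [C0 gC]] := filter_ex (filterI (nbhs_pinfty_ge (num_real 0)) hC).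
by exists C.
Qed.
End torus.

(** * The flux *)

Section flux.
Context {R : realType} (H : R -> R -> R -> R).
Hypothesis hH : admissible_flux H.
Local Notation F := (fun z : R * R * R => H z.1.1 z.1.2 z.2).

Definition Hx (x t p : R) : R := derive1 (fun y => H y t p) x.

Lemma HxE x t p : Hx x t p = partial_x F (x, t, p). Proof. by []. Qed.

Lemma HpE x t p : Hp H x t p = partial_p F (x, t, p). Proof. by []. Qed.

Lemma flux_differentiable z : differentiable F z.
Proof. by case: hH => _ [dF _] _ _ _; exact: dF. Qed.

Lemma flux_continuous : continuous F.
Proof. by move=> z; apply/differentiable_continuous/flux_differentiable. Qed.

Lemma partial_x_continuous : continuous (partial_x F).
Proof.
case: hH => _ [_ /(_ (1, 0, 0)) [dF _]] _ _ _ z.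
rewrite (_ : partial_x F = 'D_((1, 0, 0) : R * R * R) F).
  exact/differentiable_continuous/dF.
by apply/funext => w; rewrite partial_xE.
Qed.

Lemma partial_p_differentiable z : differentiable (partial_p F) z.
Proof.
case: hH => _ [_ /(_ (0, 0, 1)) [dF _]] _ _ _.
rewrite (_ : partial_p F = 'D_((0, 0, 1) : R * R * R) F) //.
by apply/funext => w; rewrite partial_pE.
Qed.

Lemma partial_p_continuous : continuous (partial_p F).
Proof.
by move=> z; apply/differentiable_continuous/partial_p_differentiable.
Qed.

Lemma flux_derivable_p x t p : derivable (H x t) p 1.
Proof. exact: (@derivable_p R F flux_differentiable (x, t) p). Qed.

Lemma flux_derivable_x x t p : derivable (fun y => H y t p) x 1.
Proof. exact: (@derivable_x R F flux_differentiable t p x). Qed.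

Lemma Hp_derivable x t p : derivable (Hp H x t) p 1.
Proof.
exact: (@derivable_p R (partial_p F) partial_p_differentiable (x, t) p).
Qed.

Lemma Hp_increasing x t p p' : p < p' -> Hp H x t p < Hp H x t p'.
Proof.
move=> pp'; rewrite -subr_gt0.
have [c _ ->] := mean_value p p' (@Hp_derivable x t).
rewrite mulr_gt0 ?subr_gt0 //.
by case: hH => _ _ /(_ x t c).
Qed.

Lemma Hp_monotone x t p p' : p <= p' -> Hp H x t p <= Hp H x t p'.
Proof.
by rewrite le_eqVlt => /predU1P[->//|pp]; exact/ltW/Hp_increasing.
Qed.

Lemma flux_tangent x t p p' : H x t p + Hp H x t p * (p' - p) <= H x t p'.
Proof.
have [c + e] := mean_value p p' (@flux_derivable_p x t).
rewrite -lerBrDl e -/(Hp H x t c).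
have [pp|pp] := leP p p'.
  by move=> /andP[pc _]; rewrite ler_wpM2r ?subr_ge0 // Hp_monotone.
by move=> /andP[_ cp]; rewrite ler_wnM2r ?subr_le0 ?(ltW pp) // Hp_monotone.
Qed.

Lemma flux_periodic_x x t p : H (x + 1) t p = H x t p.
Proof. by case: hH => -[hx _] _ _ _ _; exact: hx. Qed.

Lemma flux_periodic_t x t p : H x (t + 1) p = H x t p.
Proof. by case: hH => -[_ ht] _ _ _ _; exact: (ht x p t). Qed.

Lemma Hp_periodic_x x t p : Hp H (x + 1) t p = Hp H x t p.
Proof.
rewrite /Hp (_ : H (x + 1) t = H x t) //.
by apply/funext => q; exact: flux_periodic_x.
Qed.

Lemma Hp_periodic_t x t p : Hp H x (t + 1) p = Hp H x t p.
Proof.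
rewrite /Hp (_ : H x (t + 1) = H x t) //.
by apply/funext => q; exact: flux_periodic_t.
Qed.

Lemma Hx_periodic_x x t p : Hx (x + 1) t p = Hx x t p.
Proof.
rewrite /Hx /derive1.
rewrite (_ : (fun h => _) =
  (fun h : R => h^-1 *: (H (h + x) t p - H x t p))) //.
by apply/funext => h; rewrite addrA !flux_periodic_x.
Qed.

Lemma Hx_periodic_t x t p : Hx x (t + 1) p = Hx x t p.
Proof.
rewrite /Hx (_ : (fun y => H y (t + 1) p) = (fun y => H y t p)) //.
by apply/funext => q; exact: flux_periodic_t.
Qed.

Lemma flux_bounded (P : R) : exists2 C : R, 0 <= C &
  forall x t p, `|p| <= P -> `|H x t p| <= C.
Proof.
apply: (@torus_bounded R F P flux_continuous) => x t p.
  exact: flux_periodic_x.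
exact: flux_periodic_t.
Qed.

Lemma Hp_bounded (P : R) : exists2 C : R, 0 <= C &
  forall x t p, `|p| <= P -> `|Hp H x t p| <= C.
Proof.
apply: (@torus_bounded R (partial_p F) P partial_p_continuous) => x t p.
  exact: Hp_periodic_x.
exact: Hp_periodic_t.
Qed.

Lemma Hp_unbounded x t S : exists p1 p2 : R,
  [/\ 0 < p1, S < Hp H x t p1, p2 < 0 & Hp H x t p2 < - S].
Proof.
case: hH => _ _ _ /(_ x t) [/cvgryPgt/(_ (S + `|H x t 0|)) up] + _.
move=> /cvgryPgt/(_ (S + `|H x t 0|)) dn.
have [p1 [p1_gt1 h1]] := filter_ex (filterI (nbhs_pinfty_gt (num_real 1)) up).
have [p2 [p2_lt h2]] :=
  filter_ex (filterI (nbhs_ninfty_lt (num_real (-1))) dn).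
exists p1, p2.
have p1_gt0 : 0 < p1 by rewrite (lt_trans _ p1_gt1).
have p2_lt0 : p2 < 0 by rewrite (lt_trans p2_lt) // oppr_lt0.
split => //.
  move: h1; rewrite /= (gtr0_norm p1_gt0) ltr_pdivlMr // => h1.
  rewrite -(ltr_pM2r p1_gt0).
  have := flux_tangent x t p1 0; rewrite sub0r.
  have : `|H x t 0| * 1 <= `|H x t 0| * p1 by rewrite ler_wpM2l // ltW.
  by have := ler_norm (H x t 0); lra.
move: h2; rewrite /= (ltr0_norm p2_lt0) ltr_pdivlMr ?oppr_gt0 // => h2.
rewrite -(ltr_nM2r p2_lt0).
have := flux_tangent x t p2 0; rewrite sub0r.
have : `|H x t 0| * 1 <= `|H x t 0| * (- p2) by rewrite ler_wpM2l // lerNr ltW.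
by have := ler_norm (H x t 0); lra.
Qed.

(** Superlinearity is only assumed at each (x, t), but two tangents of slope
    beyond [S] and -[S] keep this property nearby, and by convexity they lie
    below the flux. *)
Lemma flux_superlinear (S : R) : 0 <= S ->
  exists2 C : R, 0 <= C & forall x t p, S * `|p| - C <= H x t p.
Proof.
move=> S0.
pose Q (C : R) (z : R * R * R) := forall p, S * `|p| - C <= H z.1.1 z.1.2 p.
have Qx C x t p : Q C (x + 1, t, p) = Q C (x, t, p).
  by apply: propext; split=> h p'; have := h p'; rewrite /= flux_periodic_x.
have Qt C x t p : Q C (x, t + 1, p) = Q C (x, t, p).
  by apply: propext; split=> h p'; have := h p'; rewrite /= flux_periodic_t.
have FC : Filter (pinfty_nbhs R) by exact: proper_pinfty_nbhs.
have cov (z : R * R * R) :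
    \forall z' \near z & C \near (pinfty_nbhs R), Q C z'.
  case: z => [[x t] p].
  have [p1 [p2 [p10 h1 p20 h2]]] := Hp_unbounded x t S.
  have slice (f : R * R * R -> R) (q : R) : continuous f ->
      f (z.1, q) @[z --> ((x, t, p) : R * R * R)] --> f (x, t, q).
    move=> cf.
    have pr : (z.1, q) @[z --> ((x, t, p) : R * R * R)] -->
        ((x, t, q) : R * R * R).
      exact: (@cvg_pair _ _ _ (nbhs ((x, t, p) : R * R * R))
        (nbhs ((x, t) : R * R)) (nbhs q) _ _ _ fst (cst q) cvg_fst (cvg_cst _)).
    exact: (cvg_comp _ _ pr (cf _)).
  have cH q := slice F q flux_continuous.
  have cHp q := slice _ q partial_p_continuous.
  have gt1 (a : R) : a < a + 1 by rewrite ltrDl.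
  have lt1 (a : R) : a - 1 < a by rewrite gtrBl.
  have FZ := @nbhs_filter _ ((x, t, p) : R * R * R).
  have n1 := @cvgr_gt R _ _ FZ _ _ (cHp p1) _ h1.
  have n2 := @cvgr_lt R _ _ FZ _ _ (cHp p1) _ (gt1 _).
  have n3 := @cvgr_gt R _ _ FZ _ _ (cH p1) _ (lt1 _).
  have n4 := @cvgr_lt R _ _ FZ _ _ (cHp p2) _ h2.
  have n5 := @cvgr_gt R _ _ FZ _ _ (cHp p2) _ (lt1 _).
  have n6 := @cvgr_gt R _ _ FZ _ _ (cH p2) _ (lt1 _).
  have I2 := @filterI _ _ FZ.
  have nz := I2 _ _ n1 (I2 _ _ n2 (I2 _ _ n3 (I2 _ _ n4 (I2 _ _ n5 n6)))).
  (* minus the values at 0 of the two tangents, up to the local variations *)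
  pose a1 : R := 1 - H x t p1 + (Hp H x t p1 + 1) * p1.
  pose a2 : R := 1 - H x t p2 + (Hp H x t p2 - 1) * p2.
  have nC := @filterI _ _ FC _ _
    (nbhs_pinfty_ge (num_real a1)) (nbhs_pinfty_ge (num_real a2)).
  refine (near_prod nz nC _) => -[[x' t'] q] C /=.
  move=> [{}n1 [{}n2 [{}n3 [{}n4 [{}n5 {}n6]]]]] [aC1 aC2] p' /=.
  rewrite -!HpE in n1 n2 n4 n5.
  have [p'0|p'0] := leP 0 p'.
    rewrite (ger0_norm p'0); apply: le_trans (flux_tangent x' t' p1 p').
    have := ler_wpM2r p'0 (ltW n1); have := ler_wpM2r (ltW p10) (ltW n2).
    by move: n3 aC1; rewrite /a1; clear; lra.
  rewrite (ltr0_norm p'0); apply: le_trans (flux_tangent x' t' p2 p').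
  have := ler_wnM2r (ltW p'0) (ltW n4); have := ler_wnM2r (ltW p20) (ltW n5).
  by move: n6 aC2; rewrite /a2; clear; lra.
have hC := @uniform_on_torus R R (pinfty_nbhs R) Q 0 FC Qx Qt cov.
have [C [C0 gC]] := filter_ex (filterI (nbhs_pinfty_ge (num_real 0)) hC).
by exists C => // x t p; apply: (gC x t 0); rewrite normr0.
Qed.

(** The derivative is taken at the endpoint [x], where the running cost will be
    evaluated as well; this costs only the constant 1. *)
Lemma flux_space_increment (P : R) : exists2 eta : R, 0 < eta &
  forall x y t p, `|p| <= P -> `|y - x| <= eta ->
  `|H y t p - H x t p| <= `|y - x| * (`|Hx x t p| + 1).
Proof.
pose Q (eta : R) (z : R * R * R) := forall y, `|y - z.1.1| <= eta ->
  `|H y z.1.2 z.2 - H z.1.1 z.1.2 z.2| <=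
  `|y - z.1.1| * (`|Hx z.1.1 z.1.2 z.2| + 1).
have Qx eta x t p : Q eta (x + 1, t, p) = Q eta (x, t, p).
  have e y : y - 1 - x = y - (x + 1) by rewrite opprD addrA addrAC.
  apply: propext; split=> h y /= yx.
    have := h (y + 1); rewrite /= !flux_periodic_x Hx_periodic_x.
    by rewrite opprD addrACA subrr addr0; exact.
  have := h (y - 1); rewrite /= e -(flux_periodic_x (y - 1)) subrK.
  by rewrite flux_periodic_x Hx_periodic_x; exact.
have Qt eta x t p : Q eta (x, t + 1, p) = Q eta (x, t, p).
  apply: propext; split=> h y /= /h /=.
    by rewrite !flux_periodic_t Hx_periodic_t.
  by rewrite !flux_periodic_t Hx_periodic_t.
have cov (z : R * R * R) :
    \forall z' \near z & eta \near (0^'+ : set_system R), Q eta z'.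
  have half_gt0 : 0 < 1 / 2 :> R by lra.
  have /cvgrPdist_le/(_ _ half_gt0) :
    partial_x F z' @[z' --> z] --> partial_x F z by exact: partial_x_continuous.
  move=> /nbhs_ballP [e /= e0 ez].
  have nz : nbhs z (ball z (e / 2)) by apply: nbhsx_ballx; rewrite divr_gt0.
  have ne : nbhs (0^'+ : set_system R) [set eta : R | eta < e / 2].
    by apply: nbhs_right_lt; rewrite divr_gt0.
  refine (near_prod nz ne _) => z' eta /= zz' eta_e y yx.
  case: z' zz' yx => [[x t] p] /= [[bx bt] bp] yx.
  have [c cxy ->] := mean_value x y (fun w => @flux_derivable_x w t p).
  rewrite normrM mulrC ler_wpM2l // -/(Hx c t p).
  have cx : `|x - c| < e / 2.
    apply: le_lt_trans eta_e; apply: le_trans yx; rewrite distrC.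
    exact: between_dist.
  have bh w : w < e / 2 -> w < e by lra.
  have : `|partial_x F z - partial_x F (c, t, p)| <= 1 / 2.
    apply: ez; split; [split|] => /=; [|exact: bh|exact: bh].
    by rewrite (splitr e); exact: (ball_triangle bx cx).
  have : `|partial_x F z - partial_x F (x, t, p)| <= 1 / 2.
    by apply: ez; split; [split|] => /=; exact: bh.
  rewrite -!HxE => h1 h2.
  have := ler_distD (partial_x F z) (Hx c t p) (Hx x t p).
  have := lerB_dist (Hx c t p) (Hx x t p).
  by rewrite (distrC (Hx c t p) (partial_x F z)); move: h1 h2; clear; lra.
have FC : Filter (0^'+ : set_system R) by exact: at_right_proper_filter.
have hC := @uniform_on_torus R R (0^'+) Q P FC Qx Qt cov.
have [eta [eta0 gC]] := filter_ex (filterI (nbhs_right_gt (0 : R)) hC).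
by exists eta => // x y t p pP; apply: (gC x t p pP).
Qed.

Lemma legendre_Hp x t p :
  legendre H x t (Hp H x t p) = Hp H x t p * p - H x t p.
Proof.
rewrite /legendre; apply/eqP; rewrite eq_le; apply/andP; split.
  apply: ge_sup; first by exists (Hp H x t p * p - H x t p), p.
  by move=> _ [q _ <-]; have := flux_tangent x t p q; lra.
apply: ub_le_sup; last by exists p.
exists (Hp H x t p * p - H x t p) => _ [q _ <-].
by have := flux_tangent x t p q; lra.
Qed.

(** The envelope theorem.  The momentum p' that is optimal at h + x for the
    velocity [xi] is close to [p] by monotonicity of [Hp]; testing the
    supremum at x with p' and the one at h + x with p encloses the increment of
    the Legendre transform between two increments of -[H] at fixed momenta. *)
Lemma legendre_xE x t p : legendre_x H x t (Hp H x t p) = - Hx x t p.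
Proof.
set xi := Hp H x t p.
apply: (@cvg_lim R^o); first exact: norm_hausdorff.
apply/cvgrPdist_le => e e0.
have /cvgrPdist_le/(_ e e0) /nbhs_ballP [rho /= rho0 near_p] :
    partial_x F z' @[z' --> (x, t, p)] --> partial_x F (x, t, p).
  exact: partial_x_continuous.
have s0 : 0 < rho / 2 by rewrite divr_gt0.
have cvgHp q : Hp H (h + x) t q @[h --> (0 : R)] --> Hp H x t q.
  have hx : (h + x) @[h --> (0 : R)] --> x.
    rewrite -[X in _ --> X]add0r.
    by apply: cvgD; [exact: cvg_id|exact: cvg_cst].
  have pr1 : (h + x, t) @[h --> (0 : R)] --> ((x, t) : R * R).
    exact: (@cvg_pair _ _ _ (nbhs (0 : R)) (nbhs x) (nbhs t) _ _ _
      (fun h => h + x) (cst t) hx (cvg_cst t)).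
  have pr : (h + x, t, q) @[h --> (0 : R)] --> ((x, t, q) : R * R * R).
    exact: (@cvg_pair _ _ _ (nbhs (0 : R)) (nbhs ((x, t) : R * R)) (nbhs q)
      _ _ _ (fun h => (h + x, t)) (cst q) pr1 (cvg_cst q)).
  have pc := cvg_comp _ _ pr (@partial_p_continuous (x, t, q)).
  exact: pc.
have FZ := @nbhs_filter _ (0 : R).
have p_lo : p - rho / 2 < p by rewrite gtrBl.
have p_hi : p < p + rho / 2 by rewrite ltrDl.
have lo := @cvgr_lt R _ _ FZ _ _ (cvgHp (p - rho / 2)) xi
  (Hp_increasing x t p_lo).
have hi := @cvgr_gt R _ _ FZ _ _ (cvgHp (p + rho / 2)) xi
  (Hp_increasing x t p_hi).
near=> h.
have h0 : h != 0 by near: h; exact: nbhs_dnbhs_neq.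
have hrho : `|h| < rho / 2 by near: h; exact: dnbhs0_lt.
have lo' : Hp H (h + x) t (p - rho / 2) < xi.
  by near: h; exact: (cvg_within _ lo).
have hi' : xi < Hp H (h + x) t (p + rho / 2).
  by near: h; exact: (cvg_within _ hi).
have [p' p'E xiE] : exists2 p', p' \in `[p - rho / 2, p + rho / 2]%R &
    Hp H (h + x) t p' = xi.
  apply: IVT; first by rewrite lerD2l ge0_cp // ltW.
    apply: continuous_subspaceT => q.
    exact/differentiable_continuous/derivable1_diffP/Hp_derivable.
  have le := le_trans (ltW lo') (ltW hi').
  by rewrite (min_idPl le) (max_idPr le) (ltW lo') (ltW hi').
have LhE := legendre_Hp (h + x) t p'; rewrite xiE in LhE.
have LE := legendre_Hp x t p; rewrite -/xi in LE.
have := flux_tangent (h + x) t p' p; rewrite xiE => l1.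
have := flux_tangent x t p p'; rewrite -/xi => l2.
have near_x q : `|p - q| < rho ->
    `|H (h + x) t q - H x t q - h * Hx x t p| <= e * `|h|.
  move=> pq.
  have [c cx ->] := mean_value x (h + x) (fun w => @flux_derivable_x w t q).
  rewrite addrK -/(Hx c t q) mulrC -mulrBr normrM mulrC ler_wpM2r //.
  rewrite distrC; apply: (near_p (c, t, q)).
  split; [split|] => //=; last exact: ballxx.
  rewrite /ball /= distrC; apply: le_lt_trans (between_dist cx) _.
  by rewrite addrK (lt_trans hrho) // ltr_pdivrMr // ltr_pMr // ltr1n.
have pp' : `|p - p'| < rho.
  move: p'E; rewrite in_itv /= ltr_norml => /andP[? ?].
  by apply/andP; split; lra.
have := near_x p; rewrite subrr normr0 => /(_ rho0).
rewrite ler_norml => /andP[u3 u4].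
have := near_x p' pp'; rewrite ler_norml => /andP[u1 u2].
rewrite LhE LE distrC opprK.
have -> : h^-1 *: (xi * p' - H (h + x) t p' - (xi * p - H x t p)) + Hx x t p =
    h^-1 * ((xi * p' - H (h + x) t p' - (xi * p - H x t p)) + h * Hx x t p).
  by rewrite mulrDr mulKf.
rewrite normrM normfV ler_pdivrMl ?normr_gt0 // mulrC ler_norml.
by apply/andP; split; move: l1 l2 u1 u2 u3 u4; clear; lra.
Unshelve. all: by end_near.
Qed.

Lemma Hx_growth : exists2 alpha : R, 0 < alpha & forall x t p,
  `|Hx x t p| <= alpha * (`|Hp H x t p * p - H x t p| + 1).
Proof.
case: hH => _ _ _ _ [alpha alpha0 gr]; exists alpha => // x t p.
by rewrite -normrN -legendre_xE -legendre_Hp; exact: gr.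
Qed.

(** The test momentum 2 * c in the convexity inequality bounds Hp * p - H by
    twice the running cost relative to c, up to a constant; this controls |Hx|
    through the growth of the Legendre transform. *)
Lemma running_cost_bounds (cbar : R) : 0 <= cbar -> exists C A : R,
  [/\ 0 <= C, 0 <= A &
   forall c, `|c| <= cbar -> forall x t,
   [/\ H x t c <= C, forall p, `|p| - C <= H x t p &
   forall p, 2 * (`|Hx x t p| + 1) <=
     A * ((p - c) * Hp H x t p - H x t p + C)]].
Proof.
move=> cbar0.
have [C1 C10 coer] := flux_superlinear (ler01 : 0 <= 1).
have [C2 C20 bd] := flux_bounded (2 * cbar).
have [al al0 gr] := Hx_growth.
exists (C1 + 2 * C2 + 1), (4 * al + 2); split; [lra|lra|] => c cc x t.
have bdu p : `|p| <= 2 * cbar -> H x t p <= C2.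
  by move=> pc; exact: le_trans (ler_norm _) (bd _ _ _ pc).
have cc2 : `|2 * c| <= 2 * cbar by rewrite normrM ger0_norm // ler_wpM2l.
split => [|p|p].
- by have := bdu c; have := normr_ge0 c; lra.
- by have := coer x t p; lra.
have l1 := flux_tangent x t p (2 * c); have l2 := flux_tangent x t p 0.
have l3 := flux_tangent x t p c.
have b1 := bdu _ cc2.
have b2 : H x t 0 <= C2 by apply: bdu; rewrite normr0; lra.
have b3 : H x t c <= C2 by apply: bdu; lra.
have := gr x t p; set l := Hp H x t p * p - H x t p => gx.
have nl : `|l| <= 2 * ((p - c) * Hp H x t p - H x t p) + 3 * C2.
  by rewrite ler_norml /l; apply/andP; split; lra.
have := ler_wpM2l (ltW al0) nl.
set qq := (p - c) * _ - _ in nl *.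
have q1 : 0 <= qq + C2 by rewrite /qq; lra.
have := mulr_ge0 (ltW al0) q1; have := mulr_ge0 (ltW al0) C10.
have := mulr_ge0 (ltW al0) C20.
move: gx; clearbody qq l; lra.
Qed.

(** Testing with the momenta c + 1 and c - 1 shows that the running cost is at
    least |Hp| up to a constant, and Hp is unbounded by superlinearity. *)
Lemma running_cost_large (cbar Th : R) : 0 <= cbar -> 0 <= Th ->
  exists2 M : R, 0 <= M &
  forall c, `|c| <= cbar -> forall x t p, M <= `|p - c| ->
  Th <= (p - c) * Hp H x t p - H x t p.
Proof.
move=> cbar0 Th0.
have [C2 C20 bd] := flux_bounded (cbar + 1).
have S0 : 0 <= Th + C2 + 1 by lra.
have [CS CS0 coer] := flux_superlinear S0.
exists (CS + C2 + cbar + 1) => [|c cc x t p Mp]; first by lra.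
have bdu s : `|s| <= cbar + 1 -> H x t s <= C2.
  by move=> pc; exact: le_trans (ler_norm _) (bd _ _ _ pc).
have [cl cu] : - cbar <= c /\ c <= cbar.
  by move: cc; rewrite ler_norml => /andP.
have b0 : H x t 0 <= C2 by apply: bdu; rewrite normr0; lra.
have bp : H x t (c + 1) <= C2.
  by apply: bdu; rewrite ler_norml; apply/andP; split; lra.
have bm : H x t (c - 1) <= C2.
  by apply: bdu; rewrite ler_norml; apply/andP; split; lra.
have lp := flux_tangent x t p (c + 1).
have lm := flux_tangent x t p (c - 1).
have l0 := flux_tangent x t p 0; have co := coer x t p.
have Mp' : CS + C2 + 1 <= `|p|.
  by have := ler_normB p c; move: Mp cc; lra.
have [p0|p0] := leP 0 p.
  rewrite (ger0_norm p0) in co Mp'.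
  have [hs|hs] := leP (Th + C2) (Hp H x t p); first by lra.
  by have := ler_wpM2r p0 (ltW hs); lra.
rewrite (ltr0_norm p0) in co Mp'.
have [hs|hs] := leP (Hp H x t p) (- (Th + C2)); first by lra.
by have := ler_wnM2r (ltW p0) (ltW hs); lra.
Qed.
End flux.

(** * Primitives of periodic functions *)

Section translation.
Context {R : realType}.
Local Notation mu := (@lebesgue_measure R).

Let shift_by (a : R) : measurableTypeR R -> measurableTypeR R :=
  fun x => x + a.

Let measurable_shift_by a : measurable_fun setT (shift_by a).
Proof.
by apply: measurable_funD; [exact: measurable_id|exact: measurable_cst].
Qed.

Lemma lebesgue_measure_translate (a : R) (A : set (measurableTypeR R)) :
  measurable A -> mu A = mu [set x | A (x + a)].
Proof.
move=> mA.
apply: (lebesgue_measure_unique (mu := pushforward mu (shift_by a))) mA.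
move=> _ [[b c] _ <-] /=; rewrite /pushforward.
have -> : shift_by a @^-1` `]b, c] = `]b - a, c - a]%classic.
  by apply/seteqP; split=> x /=; rewrite !in_itv /= ltrBlDr lerBrDr.
rewrite !lebesgue_measure_itv /= !lte_fin ltrD2r -!EFinB.
by congr (if _ then _%:E else _); ring.
Qed.

Lemma Rintegral_translate (f : R -> R) (a b c : R) : measurable_fun setT f ->
  mu.-integrable `[b, c] (EFin \o (fun x => f (x + a))) ->
  \int[mu]_(x in `[b + a, c + a]) f x = \int[mu]_(x in `[b, c]) f (x + a).
Proof.
move=> mf intf; rewrite /Rintegral; congr fine.
have pre : shift_by a @^-1` `[b + a, c + a]%classic = `[b, c]%classic.
  by apply/seteqP; split=> x /=; rewrite !in_itv /= !lerD2r.
transitivity (\int[pushforward mu (shift_by a)]_(x in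
    `[(b + a)%R, (c + a)%R]) (f x)%:E)%E.
  by apply: eq_measure_integral => A mA _; exact: lebesgue_measure_translate.
rewrite (integral_pushforward (@measurable_shift_by a)) ?pre //.
by apply/measurable_EFinP.
Qed.
End translation.

Section periodic_primitive.
Context {R : realType} (r : R) (u0 : R -> R).
Hypothesis hu0 : Linfty_r0 r u0.
Local Notation mu := (@lebesgue_measure R).

Definition int_on (a b : R) : R := \int[mu]_(x in `[a, b]) u0 x.

Lemma u0_measurable : measurable_fun setT u0. Proof. by case: hu0. Qed.

Lemma u0_bound_ge0 : 0 <= r.
Proof.
case: hu0 => _ _ + _; rewrite -lee_fin; apply: le_trans; exact: Lnorm_ge0.
Qed.

Lemma u0_ae_le : {ae mu, forall x, (`|u0 x|%:E <= r%:E)%E}.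
Proof.
have mu1 : (0 < mu [set: R])%E.
  by rewrite -set_itvNyy lebesgue_measure_itv /= addye // ltry.
case: hu0 => _ _ + _; rewrite unlock mu1.
by move=> /ess_supP; apply: filterS => x.
Qed.

Lemma int_abs_le a b : a <= b ->
  (\int[mu]_(x in `[a, b]) `|(u0 x)%:E| <= (r * (b - a))%:E)%E.
Proof.
move=> ab; have mab : mu `[a, b]%classic = (b - a)%:E.
  rewrite lebesgue_measure_itv /= lte_fin.
  by case: ltgtP ab => // ->; rewrite subrr.
have r0 := u0_bound_ge0.
apply: (@le_trans _ _ (\int[mu]_(x in `[a, b]) r%:E)%E); last first.
  by rewrite integral_cst //= mab EFinM.
apply: ae_ge0_le_integral => //.
- apply: measurableT_comp => //; apply/measurable_EFinP.
  by apply: measurable_funTS; exact: u0_measurable.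
- by apply: filterS u0_ae_le; [exact: (ae_filter_ringOfSetsType mu)|move=> x].
Qed.

Lemma u0_integrable a b : mu.-integrable `[a, b] (EFin \o u0).
Proof.
apply/integrableP; split.
  by apply/measurable_EFinP; apply: measurable_funTS; exact: u0_measurable.
have [ab|ba] := leP a b.
  by apply: le_lt_trans (int_abs_le ab) _; rewrite ltry.
by rewrite set_itv_ge ?bnd_simp -?ltNge // integral_set0 ltry.
Qed.

Lemma int_on_norm a b : a <= b -> `|int_on a b| <= r * (b - a).
Proof.
move=> ab; apply: le_trans (le_normr_Rintegral _ (u0_integrable a b)) _ => //.
rewrite -lee_fin; apply: le_trans (int_abs_le ab).
have /integrableP[_ fi] := u0_integrable a b.
by rewrite /Rintegral fineK // ge0_fin_numE // integral_ge0.
Qed.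

Lemma int_on_add a b c : a <= b -> b <= c ->
  int_on a c = int_on a b + int_on b c.
Proof.
move=> ab bc.
have := @Rintegral_itvB R u0 (BLeft a) (BRight c) b (u0_integrable a c).
rewrite !bnd_simp => /(_ ab bc) e.
rewrite /int_on -(Rintegral_itv_obnd_cbnd (r := b)).
  by rewrite -e addrC subrK.
apply: integrableS (u0_integrable b c) => //.
by apply: subset_itvr; rewrite bnd_simp.
Qed.

Lemma int_on_shift a b : int_on (a + 1) (b + 1) = int_on a b.
Proof.
case: hu0 => m per _ _; rewrite /int_on Rintegral_translate //.
  by under eq_Rintegral do rewrite per.
rewrite (_ : (fun x => _) = u0); first exact: u0_integrable.
by apply/funext => x; rewrite per.
Qed.

Definition primitive (x : R) : R :=
  if 0 <= x then int_on 0 x else - int_on x 0.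

Lemma primitiveB a b : a <= b -> primitive b - primitive a = int_on a b.
Proof.
move=> ab; rewrite /primitive; case: leP => b0; case: leP => a0.
- by rewrite (int_on_add a0 ab) addrC addKr.
- by rewrite opprK addrC (int_on_add (ltW a0) b0).
- by have := lt_le_trans b0 (le_trans a0 ab); rewrite ltxx.
- by rewrite (int_on_add ab (ltW b0)); lra.
Qed.

Lemma primitive_periodic x : primitive (x + 1) = primitive x.
Proof.
apply/eqP; rewrite -subr_eq0 primitiveB ?lerDl //; apply/eqP.
have unit_shift y : int_on (y + 1) (y + 1 + 1) = int_on y (y + 1).
  exact: int_on_shift.
rewrite -(subrK (Num.floor x)%:~R x).
rewrite (periodicz (f := fun y => int_on y (y + 1)) unit_shift).
set y := x - _.
have /andP[y0 y1] : 0 <= y <= 1.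
  have := floor_itv x; rewrite intrD => /andP[? ?].
  by apply/andP; split; rewrite /y; lra.
have e : int_on 1 (y + 1) = int_on 0 y by rewrite -(int_on_shift 0 y) add0r.
rewrite (int_on_add y1) ?lerDr // e addrC.
by rewrite -(int_on_add y0 y1); case: hu0.
Qed.

Lemma primitive_lipschitz a b : `|primitive b - primitive a| <= r * `|b - a|.
Proof.
wlog ab : a b / a <= b => [hw|].
  have [|ba] := boolP (a <= b); first exact: hw.
  by rewrite distrC (distrC b); apply: hw; rewrite ltW // ltNge.
by rewrite primitiveB // (ger0_norm (_ : 0 <= b - a)) ?subr_ge0 // int_on_norm.
Qed.

Lemma primitive_osc x y : `|primitive x - primitive y| <= r.
Proof.
rewrite -(subrK (Num.floor (x - y))%:~R x) (periodicz primitive_periodic).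
apply: le_trans (primitive_lipschitz _ _) _.
rewrite ler_piMr ?u0_bound_ge0 // ler_norml.
have := floor_itv (x - y); rewrite intrD => /andP[? ?].
by apply/andP; split; lra.
Qed.
End periodic_primitive.

(** * The Lax-Friedrichs scheme *)

Section grid_nodes.
Context {R : realType}.

Lemma mesh_gt0 n : (0 < n)%N -> 0 < mesh n :> R.
Proof. by move=> n0; rewrite invr_gt0 mulr_gt0 // ltr0n. Qed.

Lemma mesh_period n : (0 < n)%N -> 2 * n%:R * mesh n = 1 :> R.
Proof. by move=> n0; rewrite mulfV // mulf_neq0 // pnatr_eq0 -?lt0n. Qed.

Lemma nodeD (d : R) m m' : node d (m + m') = node d m + node d m'.
Proof. by rewrite /node intrD mulrDl. Qed.

Lemma node1 (d : R) : node d 1 = d. Proof. by rewrite /node mul1r. Qed.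

Lemma node_period N m : (0 < N)%N ->
  node (mesh N) (m + (2 * N)%:Z) = node (mesh N) m + 1 :> R.
Proof.
move=> N0; rewrite nodeD {2}/node -[X in _ = _ + X](mesh_period N0).
by rewrite -[(2 * N)%:Z%:~R]/((2 * N)%:R) natrM.
Qed.

Lemma on_grid_index k j : on_grid k (2 * j + k%:Z).
Proof. by apply/dvdzP; exists (j + k%:Z); ring. Qed.

Lemma on_gridP k m : on_grid k m -> exists j, m = 2 * j + k%:Z.
Proof.
by move=> /dvdzP[q e]; exists (q - k%:Z); rewrite -[m](addrK k%:Z) e; ring.
Qed.
End grid_nodes.

Section lax_friedrichs_scheme.
Context {R : realType} (H : R -> R -> R -> R) (N K : nat) (c r : R).
Context (u0 : R -> R).
Hypothesis hx : forall x t p, H (x + 1) t p = H x t p.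
Hypotheses (N0 : (0 < N)%N) (K0 : (0 < K)%N).
Hypothesis hu0 : Linfty_r0 r u0.
Local Notation dx := (mesh N : R).
Local Notation dt := (mesh K : R).

Lemma cell_average m :
  (2 * dx)^-1 *
    \int[lebesgue_measure]_(y in `[node dx m - dx, node dx m + dx]) u0 y =
  (primitive u0 (node dx (m + 1)) - primitive u0 (node dx (m - 1))) / (2 * dx).
Proof.
have d0 := mesh_gt0 (R := R) N0.
rewrite !nodeD -[node dx (-1)]/(- 1 * dx) mulN1r node1 mulrC.
by rewrite (primitiveB hu0) //; lra.
Qed.

(** The scheme is explicit, so it can be run at all nodes, whatever their
    parity. *)
Fixpoint LF_iterate (k : nat) : int -> R :=
  match k with
  | 0 => fun m =>
      (primitive u0 (node dx (m + 1)) - primitive u0 (node dx (m - 1))) /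
      (2 * dx)
  | k'.+1 => fun m => let w := LF_iterate k' in
      (w (m - 1) + w (m + 1)) / 2 -
      dt * ((H (node dx (m + 1)) (node dt k') (c + w (m + 1)) -
             H (node dx (m - 1)) (node dt k') (c + w (m - 1))) / (2 * dx))
  end.

Lemma LF_iterate_periodic k m :
  LF_iterate k (m + (2 * N)%:Z) = LF_iterate k m.
Proof.
have shift i d : node dx (i + (2 * N)%:Z + d) = node dx (i + d) + 1.
  by rewrite addrAC node_period.
elim: k m => [|k ih] m /=; first by rewrite !shift !(primitive_periodic hu0).
have ih_shift d : LF_iterate k (m + (2 * N)%:Z + d) = LF_iterate k (m + d).
  by rewrite addrAC ih.
by rewrite !shift !ih_shift !hx.
Qed.

Lemma LF_solution_exists : exists u, LF_solution H N K c u0 u.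
Proof.
exists LF_iterate; split.
- by rewrite /LF_initial /= => m _; rewrite cell_average.
- move=> k m _; rewrite LF_iterate_periodic; split => //.
  by rewrite -[in RHS](subrK (2 * N)%:Z m) LF_iterate_periodic.
rewrite /LF_step /= => k m _.
rewrite addrK (_ : m + 1 + 1 = m + 2) -?addrA //.
have d0 := mesh_gt0 (R := R) N0; have e0 := mesh_gt0 (R := R) K0.
by field; rewrite !gt_eqF.
Qed.

Definition at_nodes (f : R -> R -> R -> R) (k : nat) (j : int) (p : R) : R :=
  f (node dx (2 * j + k%:Z)) (node dt k) p.

Fixpoint HJ_iterate (k : nat) : int -> R :=
  match k with
  | 0 => fun j => primitive u0 (node dx (2 * j - 1))
  | k'.+1 => fun j => let w := HJ_iterate k' in
      (w j + w (j + 1)) / 2 -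
      dt * at_nodes H k' j (c + (w (j + 1) - w j) / (2 * dx))
  end.

(** The Lax-Friedrichs scheme is the spatial difference of the Hamilton-Jacobi
    scheme. *)
Lemma slope_HJ_iterate u : LF_solution H N K c u0 u ->
  forall k j, u k (2 * j + k%:Z) = slope dx HJ_iterate k j.
Proof.
move=> [init _ step].
have d0 := mesh_gt0 (R := R) N0; have e0 := mesh_gt0 (R := R) K0.
elim=> [j|k ih j].
  rewrite init ?cell_average ?on_grid_index //= /slope /= addr0.
  by rewrite mulrDr mulr1 -addrA.
have := step k _ (on_grid_index k j).
have -> : 2 * j + k%:Z + 1 = 2 * j + k.+1%:Z.
  by rewrite -[k.+1]addn1 PoszD addrA.
have -> : 2 * j + k%:Z + 2 = 2 * (j + 1) + k%:Z by rewrite mulrDr mulr1 addrAC.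
rewrite !ih; set u' := u _ _.
rewrite [slope dx _ k.+1 j]/slope /= -/(slope dx HJ_iterate k j).
rewrite -/(slope dx HJ_iterate k (j + 1)) /at_nodes.
set h1 := H _ _ (c + slope _ _ _ j); set h2 := H _ _ _ => e.
have -> : u' = (slope dx HJ_iterate k j + slope dx HJ_iterate k (j + 1)) / 2 -
    dt * ((h2 - h1) / (2 * dx)).
  have := congr1 ( *%R dt) e.
  rewrite mulr0 mulrDr mulrCA divff ?gt_eqF // mulr1.
  by move=> {}e; lra.
by rewrite /slope; field; rewrite gt_eqF.
Qed.

Lemma at_nodes_periodic k j p :
  at_nodes H k (j + N%:Z) p = at_nodes H k j p.
Proof.
by rewrite /at_nodes mulrDr addrAC -[2 * N%:Z]/((2 * N)%N%:Z) node_period ?hx.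
Qed.

Lemma HJ_iterate0_periodic j : HJ_iterate 0 (j + N%:Z) = HJ_iterate 0 j.
Proof.
rewrite /= -(primitive_periodic hu0 (node dx (2 * j - 1))) -node_period //.
by rewrite mulrDr addrAC.
Qed.

Lemma slope_HJ_iterate0 j : `|slope dx HJ_iterate 0 j| <= r.
Proof.
have dx2 : 0 < 2 * dx by rewrite mulr_gt0 ?mesh_gt0.
rewrite /slope /= normrM normfV (gtr0_norm dx2) ler_pdivrMr //.
apply: le_trans (primitive_lipschitz hu0 _ _) _.
rewrite /node -mulrBl -intrB (_ : _ - _ = 2) ?(gtr0_norm dx2) //.
by ring.
Qed.

(** The increment of [H] between neighbouring nodes is compared to its
    derivative at the second node; this is where slopes must be bounded. *)
Lemma at_nodes_flux_bounds (hH : admissible_flux H)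
    (cbar C A M Th Rb S eta lam : R) :
  0 <= lam -> `|c| <= cbar ->
  (forall x t, [/\ H x t c <= C, forall p, `|p| - C <= H x t p &
     forall p, 2 * (`|Hx H x t p| + 1) <=
       A * ((p - c) * Hp H x t p - H x t p + C)]) ->
  (forall x t p, M <= `|p - c| -> Th <= (p - c) * Hp H x t p - H x t p) ->
  (forall x t p, `|p| <= Rb + cbar -> `|Hp H x t p| <= S) ->
  (forall x y t p, `|p| <= Rb + cbar -> `|y - x| <= eta ->
    `|H y t p - H x t p| <= `|y - x| * (`|Hx H x t p| + 1)) ->
  lam * S <= 1 / 2 -> 2 * dx <= eta ->
  flux_bounds dx lam c C A M Th Rb (at_nodes H) (at_nodes (Hp H))
    (at_nodes (fun x t p => `|Hx H x t p| + 1)).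
Proof.
move=> lam0 cc cost large slope_S incr lamS dx_eta.
have dx2 : 0 < 2 * dx by rewrite mulr_gt0 ?mesh_gt0.
have near_c p : `|p - c| <= Rb -> `|p| <= Rb + cbar.
  by have := ler_normD (p - c) c; rewrite subrK; lra.
split.
- by move=> *; exact: flux_tangent.
- by move=> k j; have [] := cost (node dx (2 * j + k%:Z)) (node dt k).
- move=> k j p; have [_ + _] := cost (node dx (2 * j + k%:Z)) (node dt k).
  exact.
- by move=> k j p; exact: large.
- move=> k j p; have [_ _] := cost (node dx (2 * j + k%:Z)) (node dt k).
  exact.
- move=> k j j' p pc jj.
  have gap : `|node dx (2 * j + k%:Z) - node dx (2 * j' + k%:Z)| = 2 * dx.
    rewrite /node; case: jj => ->; first rewrite distrC.
      rewrite (_ : _ - _ = 2 * dx) ?(gtr0_norm dx2) //.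
      by rewrite !intrD !intrM !intrD; ring.
    rewrite (_ : _ - _ = 2 * dx) ?(gtr0_norm dx2) //.
    by rewrite !intrD !intrM !intrD; ring.
  rewrite distrC -{1}gap; apply: incr; first exact: near_c.
  by rewrite gap.
- move=> k j p pc; apply: le_trans lamS; rewrite ler_wpM2l //.
  exact/slope_S/near_c.
Qed.
End lax_friedrichs_scheme.

Theorem theorem3p1 (R : realType) (H : R -> R -> R -> R)
    (hH : admissible_flux H)
    (r : R) (hr : 0 < r) (c0 c1 : R) (hc : c0 <= c1) :
  exists2 lambda1 : R, 0 < lambda1 &
  forall lambda0 : R, 0 < lambda0 -> lambda0 < lambda1 ->
  exists2 delta : R, 0 < delta &
  forall N K : nat, (0 < N)%N -> (N <= K)%N ->
  let dx : R := mesh N in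
  let dt : R := mesh K in
  let lambda := dt / dx in
  lambda0 <= lambda -> lambda < lambda1 -> dx <= delta ->
  forall c : R, c0 <= c -> c <= c1 ->
  forall u0 : R -> R, Linfty_r0 r u0 ->
    (exists u : nat -> int -> R, LF_solution H N K c u0 u) /\
    (forall u : nat -> int -> R, LF_solution H N K c u0 u ->
       forall (k : nat) (m : int), on_grid k m ->
         `|Hp H (node dx m) (node dt k) (c + u k m)| <= lambda1^-1 /\
         lambda1^-1 < lambda^-1).
Proof.
pose cbar := `|c0| + `|c1|.
have cbar0 : 0 <= cbar by rewrite addr_ge0.
have [C [A [C_nneg A0 cost]]] := running_cost_bounds hH cbar0.
pose C0 := r + 2 * C + cbar + 1; pose C1 := C0 + C.
have C0_gt0 : 0 < C0 by rewrite /C0; lra.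
have C1_gt0 : 0 < C1 by rewrite /C1; lra.
have Th0 : 0 <= 16 * C1 by lra.
have [M M0 large] := running_cost_large hH cbar0 Th0.
have [R0 [B [Rb [r_R0 amps]]]] :=
  amplitudes_exist A0 C_nneg (ltW C0_gt0) C1_gt0 M0 (ltW hr) erefl.
have [S S0 slope_S] := Hp_bounded hH (Rb + cbar).
have [eta eta0 incr] := flux_space_increment hH (Rb + cbar).
have lam1_gt0 : 0 < (2 * S + 1)^-1 by rewrite invr_gt0; lra.
exists (2 * S + 1)^-1 => // lam0 lam0_gt0 _.
have eta2 : 0 < eta / 2 by rewrite divr_gt0.
have [delta delta0 small] := fine_mesh_exists C_nneg
  (le_trans (ltW hr) r_R0) (B_ge0 amps) lam0_gt0 eta2.
exists delta => // N K N0 NK dx dt lam lam_ge lam_lt dx_le c c0c cc1 u0 hu0.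
have K0 : (0 < K)%N by exact: leq_trans NK.
have dx0 : 0 < dx by exact: mesh_gt0.
have dt0 : 0 < dt by exact: mesh_gt0.
have lam_gt0 : 0 < lam by rewrite divr_gt0.
have dtE : lam * dx = dt by rewrite divfK ?gt_eqF.
split; first exact: (LF_solution_exists c (flux_periodic_x hH) N0 K0 hu0).
move=> u sol k m km; split; last by rewrite ltf_pV2.
have cc : `|c| <= cbar.
  have := ler_norm c1; have := ler_norm (- c0); rewrite normrN.
  have := normr_ge0 c0; have := normr_ge0 c1; move: c0c cc1.
  by rewrite ler_norml /cbar; clear => *; apply/andP; split; lra.
have [lamS lam_le1] : lam * S <= 1 / 2 /\ lam <= 1.
  have : lam * (2 * S + 1) <= 1.
    by rewrite -ler_pdivlMr ?div1r ?(ltW lam_lt) //; lra.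
  by move=> le1; have lS := mulr_ge0 (ltW lam_gt0) S0; split; lra.
have unit_steps : (2 * K)%:R * (lam * dx) = 1.
  by rewrite dtE natrM mesh_period.
have [dx_eta grid] := small _ _ _ dx0 dx_le lam_ge lam_le1 unit_steps.
have {}dx_eta : 2 * dx <= eta by move: dx_eta; clear; lra.
have flux := at_nodes_flux_bounds K N0 hH (ltW lam_gt0) cc (cost c cc)
  (large c cc) slope_S incr lamS dx_eta.
have [j ->] := on_gridP km.
rewrite (slope_HJ_iterate N0 K0 hu0 sol) invrK.
apply: (@le_trans _ _ S); last by move: S0; clear; lra.
apply: slope_S; apply: le_trans (ler_normD _ _) _; rewrite addrC lerD //.
apply: (slope_bounded_forever (per := N) amps grid flux) => //.
- by move=> i l; rewrite /slope /= dtE.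
- by move: cc hr; rewrite /C0; clear; lra.
- exact: mesh_period.
- by move=> i l p; exact: at_nodes_periodic (flux_periodic_x hH) _ _ _ _.
- exact: (HJ_iterate0_periodic _ _ _ N0 hu0).
- move=> i l; apply: le_trans (ler_norm _) _.
  apply: le_trans (primitive_osc hu0 _ _) _.
  by move: C_nneg cbar0; rewrite /C0; clear; lra.
- by move=> i; exact: le_trans (slope_HJ_iterate0 _ _ _ N0 hu0 _) r_R0.
Qed.
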